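(* Let $E$ be an ellipse and $P_t=(p_1(t),\dots,p_n(t))$ a 1-parameter family of $n$-periodic billiard trajectories in $E$. For each $i$ let $q_i(t)$ be the intersection point of the tangent lines to $E$ at $p_i(t)$ and $p_{i+1}(t)$, and let $\beta_i(t)$ be the angle at $q_i(t)$ of the triangle $p_i(t)\,q_i(t)\,p_{i+1}(t)$ (so that the $\beta_i$ are the angles of the polygon formed by the tangent lines to $E$ at the vertices of $P_t$). Then $\prod_{i=1}^n\cos\beta_i(t)$ is independent of $t$.
   Context: An $n$-periodic billiard trajectory in the ellipse $E$ is a closed polygon $P=(p_1,\dots,p_n)$ (indices mod $n$) with all $p_i\in E$ that obeys the law of reflection at every vertex: the segments $p_ip_{i-1}$ and $p_ip_{i+1}$ make equal angles with the tangent line to $E$ at $p_i$. All sides of such a trajectory are tangent to a common conic confocal with $E$ (the caustic). A 1-parameter family of $n$-periodic billiard trajectories is a continuous family of such polygons all tangent to the same confocal caustic (such a family exists by the Poncelet porism). It is assumed the tangent lines at consecutive vertices intersect (i.e. are not parallel) throughout the family. *)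

(* Defs.v *)
From Stdlib Require Import Reals Lra.
Open Scope R_scope.

Definition pt := (R * R)%type.
Definition dot (u v : pt) : R := fst u * fst v + snd u * snd v.
Definition cross (u v : pt) : R := fst u * snd v - snd u * fst v.
Definition vsub (u v : pt) : pt := (fst u - fst v, snd u - snd v).
Definition vopp (u : pt) : pt := (- fst u, - snd u).
Definition vnorm (u : pt) : R := sqrt (dot u u).
Definition vangle (u v : pt) : R := acos (dot u v / (vnorm u * vnorm v)).

(* A general ellipse  { x | (x - c)^T A (x - c) = 1 },
   A = [[ea, eb], [eb, ed]] symmetric positive definite. *)
Record ellipse := mkEllipse { ec : pt; ea : R; eb : R; ed : R }.
Definition is_ellipse (E : ellipse) : Prop :=
  0 < ea E /\ 0 < ea E * ed E - eb E * eb E.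
Definition on_ellipse (E : ellipse) (p : pt) : Prop :=
  let u := vsub p (ec E) in
  ea E * fst u * fst u + 2 * eb E * fst u * snd u + ed E * snd u * snd u = 1.
(* (half) gradient A (p - c): normal vector to E at p *)
Definition grad (E : ellipse) (p : pt) : pt :=
  let u := vsub p (ec E) in
  (ea E * fst u + eb E * snd u, eb E * fst u + ed E * snd u).
Definition tangent_dir (E : ellipse) (p : pt) : pt :=
  (- snd (grad E p), fst (grad E p)).

Definition nxt (n i : nat) : nat := ((i + 1) mod n)%nat.
Definition prv (n i : nat) : nat := ((i + n - 1) mod n)%nat.

(* An n-periodic billiard trajectory: vertices p 0, ..., p (n-1) (indices mod n),
   on E, consecutive vertices distinct, and the law of reflection at each vertex:
   the segments p_i p_{i-1} and p_i p_{i+1} make equal angles with the tangent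
   line at p_i (measured with opposite directions of the tangent line). *)
Definition billiard_traj (E : ellipse) (n : nat) (p : nat -> pt) : Prop :=
  forall i, (i < n)%nat ->
    on_ellipse E (p i) /\
    p i <> p (nxt n i) /\
    vangle (vsub (p (prv n i)) (p i)) (tangent_dir E (p i)) =
    vangle (vsub (p (nxt n i)) (p i)) (vopp (tangent_dir E (p i))).

(* Confocal conics to E: in tangential (dual) form, with A^{-1} the inverse
   matrix, the conic with parameter lam has dual matrix M = A^{-1} - lam I:
   the line { z | nv . (z - c) = h } is tangent to it iff nv^T M nv = h^2.
   (For A = diag(1/a^2,1/b^2) this is x^2/(a^2-lam) + y^2/(b^2-lam) = 1.) *)
Definition detA (E : ellipse) : R := ea E * ed E - eb E * eb E.
Definition confM11 (E : ellipse) (lam : R) : R := ed E / detA E - lam.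
Definition confM12 (E : ellipse) (lam : R) : R := - eb E / detA E.
Definition confM22 (E : ellipse) (lam : R) : R := ea E / detA E - lam.
Definition confocal_param (E : ellipse) (lam : R) : Prop :=
  confM11 E lam * confM22 E lam - confM12 E lam * confM12 E lam <> 0.
Definition line_tangent_confocal (E : ellipse) (lam : R) (x y : pt) : Prop :=
  let d := vsub y x in
  let nv : pt := (- snd d, fst d) in
  confM11 E lam * fst nv * fst nv + 2 * confM12 E lam * fst nv * snd nv
    + confM22 E lam * snd nv * snd nv
  = dot nv (vsub x (ec E)) * dot nv (vsub x (ec E)).

(* Intersection point of the tangent lines to E at p1 and p2 (Cramer's rule for
   g1 . z = g1 . p1, g2 . z = g2 . p2 with g = grad); meaningful when the
   tangent lines are not parallel, i.e. cross (grad E p1) (grad E p2) <> 0. *)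
Definition tangent_intersection (E : ellipse) (p1 p2 : pt) : pt :=
  let g1 := grad E p1 in let g2 := grad E p2 in
  let k1 := dot g1 p1 in let k2 := dot g2 p2 in
  let D := cross g1 g2 in
  ((k1 * snd g2 - k2 * snd g1) / D, (fst g1 * k2 - fst g2 * k1) / D).

Definition beta (E : ellipse) (n : nat) (p : nat -> pt) (i : nat) : R :=
  let q := tangent_intersection E (p i) (p (nxt n i)) in
  vangle (vsub (p i) q) (vsub (p (nxt n i)) q).

Fixpoint prodR (n : nat) (f : nat -> R) : R :=
  match n with O => 1 | S m => prodR m f * f m end.

Definition interval (I : R -> Prop) : Prop :=
  forall t s r, I t -> I s -> t <= r <= s -> I r.

Definition billiard_family (E : ellipse) (n : nat) (I : R -> Prop)
    (P : R -> nat -> pt) : Prop :=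
  interval I /\
  (forall t, I t -> billiard_traj E n (P t)) /\
  (forall i t, (i < n)%nat -> I t -> forall eps, 0 < eps ->
     exists delta, 0 < delta /\
       forall s, I s -> Rabs (s - t) < delta -> vnorm (vsub (P s i) (P t i)) < eps) /\
  (exists lam, confocal_param E lam /\
     forall t i, I t -> (i < n)%nat ->
       line_tangent_confocal E lam (P t i) (P t (nxt n i))).

(* Main.v *)
(* Let A be the matrix of the ellipse, u a vertex relative to the centre, g = A u, w the
   unit direction of the side leaving u, and D = det A. Tangency to the caustic with
   parameter lam says g . w = - J with J^2 = lam D at the start of each side and
   g . w = J at its end. With Q = w . A w one finds, for consecutive vertices,
     cos beta_i = - (D - J^2 tr A) / (Q_i |g_i| |g_{i+1}|).
   Moving the polygon with u' = s rho(g), w' = c rho(w), where s = g x w, c = D (u x w) and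
   rho is the quarter turn, is compatible with the billiard map, and along this motion
     (log cos beta_i)' = J D / |g_i|^2 - J D / |g_{i+1}|^2,
   which telescopes around a closed polygon.

   The given family is only continuous in t, so "derivative along the motion" is taken
   relative to a two-point function eta(s,t) defined from the increments of (u, w) between
   times s and t. Locally |eta(s,t)| <= K |X s - X t| for a continuous X, hence a quantity
   f of zero derivative satisfies |f s - f t| <= C (X s - X t)^2, and repeatedly halving the
   interval of values of X shows that f is locally constant. *)
Require Import Defs.
From Stdlib Require Import Reals Lra Lia Psatz.
From Coquelicot Require Import Coquelicot.
Open Scope R_scope.

(** * Differentiation relative to a two-point function *)

(** Uniform bounds on [m] and [l] are part of the notion so that it is stable under products. The
    error is measured against [|eta s t|], whatever the size of [s - t]. *)
Definition approx (U : R -> Prop) (eta m : R -> R -> R) (l : R -> R) : Prop :=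
  exists C, forall s t, U s -> U t ->
    Rabs (m s t) <= C /\ Rabs (l t) <= C /\
    Rabs (m s t - l t) <= C * Rabs (eta s t).

Definition bounded_on (U : R -> Prop) (a : R -> R) : Prop :=
  exists C, forall t, U t -> Rabs (a t) <= C.

(* Caratheodory's form of the derivative, with [eta s t] in place of [s - t]; no lower
   bound on [eta] is needed. *)
Definition cder (U : R -> Prop) (eta : R -> R -> R) (a a' : R -> R) : Prop :=
  bounded_on U a /\
  exists m, approx U eta m a' /\
    forall s t, U s -> U t -> a s - a t = eta s t * m s t.

Lemma approx_plus U eta m1 m2 l1 l2 :
  approx U eta m1 l1 -> approx U eta m2 l2 ->
  approx U eta (fun s t => m1 s t + m2 s t) (fun t => l1 t + l2 t).
Proof.
  intros [C1 H1] [C2 H2]; exists (C1 + C2); intros s t Hs Ht.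
  destruct (H1 s t Hs Ht) as (A1 & B1 & E1), (H2 s t Hs Ht) as (A2 & B2 & E2).
  repeat split.
  - eapply Rle_trans; [apply Rabs_triang | lra].
  - eapply Rle_trans; [apply Rabs_triang | lra].
  - replace (m1 s t + m2 s t - (l1 t + l2 t))
      with ((m1 s t - l1 t) + (m2 s t - l2 t)) by ring.
    eapply Rle_trans; [apply Rabs_triang | lra].
Qed.

Lemma approx_mult U eta m1 m2 l1 l2 :
  approx U eta m1 l1 -> approx U eta m2 l2 ->
  approx U eta (fun s t => m1 s t * m2 s t) (fun t => l1 t * l2 t).
Proof.
  intros [C1 H1] [C2 H2]; exists (2 * (C1 * C2)); intros s t Hs Ht.
  destruct (H1 s t Hs Ht) as (A1 & B1 & E1), (H2 s t Hs Ht) as (A2 & B2 & E2).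
  pose proof (Rabs_pos (m1 s t)); pose proof (Rabs_pos (m2 s t)).
  pose proof (Rabs_pos (l1 t)); pose proof (Rabs_pos (l2 t)).
  assert (Hm : Rabs (m1 s t) * Rabs (m2 s t) <= C1 * C2)
    by (apply Rmult_le_compat; lra).
  assert (Hl : Rabs (l1 t) * Rabs (l2 t) <= C1 * C2)
    by (apply Rmult_le_compat; lra).
  assert (0 <= C1 * C2) by nra.
  repeat split; try (rewrite Rabs_mult; lra).
  replace (m1 s t * m2 s t - l1 t * l2 t)
    with (m1 s t * (m2 s t - l2 t) + l2 t * (m1 s t - l1 t)) by ring.
  eapply Rle_trans; [apply Rabs_triang |]; rewrite !Rabs_mult.
  assert (Rabs (m1 s t) * Rabs (m2 s t - l2 t) <= C1 * (C2 * Rabs (eta s t)))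
    by (apply Rmult_le_compat; try apply Rabs_pos; lra).
  assert (Rabs (l2 t) * Rabs (m1 s t - l1 t) <= C2 * (C1 * Rabs (eta s t)))
    by (apply Rmult_le_compat; try apply Rabs_pos; lra).
  lra.
Qed.

Lemma approx_right U eta a :
  bounded_on U a -> approx U eta (fun _ t => a t) a.
Proof.
  intros [C H]; exists C; intros s t Hs Ht; pose proof (H t Ht) as HC.
  pose proof (Rabs_pos (a t)); pose proof (Rabs_pos (eta s t)).
  repeat split; try assumption.
  rewrite Rminus_diag, Rabs_R0; nra.
Qed.

Lemma approx_const U eta k : approx U eta (fun _ _ => k) (fun _ => k).
Proof. apply (approx_right U eta (fun _ => k)); exists (Rabs k); intros; lra. Qed.

Lemma approx_ext U eta m l m' l' :
  approx U eta m l ->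
  (forall s t, U s -> U t -> m s t = m' s t) -> (forall t, U t -> l t = l' t) ->
  approx U eta m' l'.
Proof.
  intros [C H] Hm Hl; exists C; intros s t Hs Ht.
  rewrite <- (Hm s t Hs Ht), <- (Hl t Ht); auto.
Qed.

(** A bounded difference quotient already makes [a s] equal to [a t] up to a multiple of [eta s t].
    This can be used before any derivative is known. *)
Lemma approx_left U eta a m C :
  bounded_on U a -> (forall s t, U s -> U t -> a s - a t = eta s t * m s t) ->
  (forall s t, U s -> U t -> Rabs (m s t) <= C) ->
  approx U eta (fun s _ => a s) a.
Proof.
  intros [K HK] Hd Hm; exists (Rmax K C); intros s t Hs Ht.
  pose proof (Rmax_l K C); pose proof (Rmax_r K C).
  repeat split; try (eapply Rle_trans; [apply HK |]; assumption).
  rewrite (Hd s t Hs Ht), Rabs_mult, Rmult_comm.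
  apply Rmult_le_compat_r; [apply Rabs_pos |].
  eapply Rle_trans; [apply Hm |]; assumption.
Qed.

Lemma cder_approx_left U eta a a' :
  cder U eta a a' -> approx U eta (fun s _ => a s) a.
Proof.
  intros [Hb (m & [C Hm] & Hd)].
  apply (approx_left U eta a m C Hb Hd); intros s t Hs Ht; apply (Hm s t Hs Ht).
Qed.

Lemma cder_ext U eta a a' b b' :
  cder U eta a a' -> (forall t, U t -> a t = b t) -> (forall t, U t -> a' t = b' t) ->
  cder U eta b b'.
Proof.
  intros [[C HC] (m & Hm & Hd)] Hab Hab'; split.
  - exists C; intros t Ht; rewrite <- Hab; auto.
  - exists m; split; [apply (approx_ext _ _ _ _ _ _ Hm); auto |].
    intros s t Hs Ht; rewrite <- !Hab; auto.
Qed.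

Lemma cder_const U eta k : cder U eta (fun _ => k) (fun _ => 0).
Proof.
  split; [exists (Rabs k); intros; lra |].
  exists (fun _ _ => 0); split; [apply approx_const | intros; ring].
Qed.

Lemma cder_plus U eta a a' b b' :
  cder U eta a a' -> cder U eta b b' ->
  cder U eta (fun t => a t + b t) (fun t => a' t + b' t).
Proof.
  intros [[C HC] (m & Hm & Hd)] [[K HK] (k & Hk & He)]; split.
  - exists (C + K); intros t Ht; pose proof (HC t Ht); pose proof (HK t Ht).
    eapply Rle_trans; [apply Rabs_triang | lra].
  - exists (fun s t => m s t + k s t); split; [now apply approx_plus |].
    intros s t Hs Ht; pose proof (Hd s t Hs Ht); pose proof (He s t Hs Ht); lra.
Qed.

Lemma cder_mult U eta a a' b b' :
  cder U eta a a' -> cder U eta b b' ->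
  cder U eta (fun t => a t * b t) (fun t => a' t * b t + a t * b' t).
Proof.
  intros Ha Hb; pose proof (cder_approx_left _ _ _ _ Hb) as Hbl.
  destruct Ha as [Ba (m & Hm & Hd)], Hb as [Bb (k & Hk & He)].
  pose proof (approx_right U eta a Ba) as Har; split.
  - destruct Ba as [C HC], Bb as [K HK]; exists (C * K); intros t Ht.
    rewrite Rabs_mult; apply Rmult_le_compat; try apply Rabs_pos; auto.
  - exists (fun s t => m s t * b s + a t * k s t); split.
    + apply approx_plus; now apply approx_mult.
    + intros s t Hs Ht; pose proof (Hd s t Hs Ht); pose proof (He s t Hs Ht).
      replace (a s * b s - a t * b t)
        with ((a s - a t) * b s + a t * (b s - b t)) by ring.
      rewrite H, H0; ring.
Qed.

Lemma cder_scal U eta k a a' :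
  cder U eta a a' -> cder U eta (fun t => k * a t) (fun t => k * a' t).
Proof.
  intros H; apply (cder_ext _ _ _ _ _ _ (cder_mult _ _ _ _ _ _ (cder_const U eta k) H));
    intros; ring.
Qed.

Lemma cder_inv U eta a a' e :
  cder U eta a a' -> 0 < e -> (forall t, U t -> e <= a t) ->
  cder U eta (fun t => / a t) (fun t => - a' t * / a t * / a t).
Proof.
  intros [Ba (m & Hm & Hd)] He Hea.
  assert (Hb : bounded_on U (fun t => / a t)).
  { exists (/ e); intros t Ht; pose proof (Hea t Ht).
    rewrite Rabs_pos_eq by (left; apply Rinv_0_lt_compat; lra).
    apply Rinv_le_contravar; lra. }
  assert (Hdi : forall s t, U s -> U t ->
    / a s - / a t = eta s t * (- m s t * / a s * / a t)).
  { intros s t Hs Ht; pose proof (Hea s Hs); pose proof (Hea t Ht).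
    replace (/ a s - / a t) with (- (a s - a t) * / a s * / a t) by (field; lra).
    rewrite (Hd s t Hs Ht); ring. }
  split; [assumption |].
  exists (fun s t => - m s t * / a s * / a t); split; [| assumption].
  (* The quotient contains [/ a s], which has to be compared with [/ a t]. *)
  assert (Hl : approx U eta (fun s _ => / a s) (fun t => / a t)).
  { destruct Hb as [K HK], Hm as [C HC].
    eapply approx_left with (C := C * K * K); [exists K; assumption | exact Hdi |].
    intros s t Hs Ht; cbv beta; rewrite !Rabs_mult, Rabs_Ropp.
    pose proof (HK s Hs); pose proof (HK t Ht); destruct (HC s t Hs Ht) as [HC1 _].
    pose proof (Rabs_pos (/ a s)); pose proof (Rabs_pos (/ a t)).
    pose proof (Rabs_pos (m s t)).
    apply Rmult_le_compat; try nra; apply Rmult_le_compat; nra. }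
  apply approx_mult; [| now apply approx_right].
  apply approx_mult; [| assumption].
  apply (approx_ext _ _ _ _ _ _ (approx_mult _ _ _ _ _ _ (approx_const U eta (-1)) Hm));
    intros; ring.
Qed.

(** Rationalising writes the quotient of the root as [m s t] over [sqrt (a s) + sqrt (a t)]; the
    bound [e] keeps this denominator away from zero. *)
Lemma cder_sqrt U eta a a' e :
  cder U eta a a' -> 0 < e -> (forall t, U t -> e <= a t) ->
  cder U eta (fun t => sqrt (a t)) (fun t => a' t * / (2 * sqrt (a t))).
Proof.
  intros [Ba (m & Hm & Hd)] He Hea.
  assert (Hse : 0 < sqrt e) by now apply sqrt_lt_R0.
  assert (Hs0 : forall t, U t -> sqrt e <= sqrt (a t))
    by (intros t Ht; apply sqrt_le_1_alt; auto).
  assert (Hb : bounded_on U (fun t => sqrt (a t))).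
  { destruct Ba as [C HC]; exists (sqrt C); intros t Ht.
    rewrite Rabs_pos_eq by apply sqrt_pos.
    apply sqrt_le_1_alt; eapply Rle_trans; [apply Rle_abs | auto]. }
  assert (Hds : forall s t, U s -> U t -> sqrt (a s) - sqrt (a t) =
     eta s t * (m s t * / (sqrt (a s) + sqrt (a t)))).
  { intros s t Hs Ht; rewrite <- Rmult_assoc, <- (Hd s t Hs Ht).
    pose proof (Hs0 s Hs); pose proof (Hs0 t Ht).
    pose proof (Hea s Hs); pose proof (Hea t Ht).
    rewrite <- (sqrt_sqrt (a s)) at 2 by lra.
    rewrite <- (sqrt_sqrt (a t)) at 2 by lra.
    field; lra. }
  assert (Hinv : forall s t, U s -> U t ->
     0 < / (sqrt (a s) + sqrt (a t)) <= / sqrt e).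
  { intros s t Hs Ht; pose proof (Hs0 s Hs); pose proof (Hs0 t Ht); split.
    - apply Rinv_0_lt_compat; lra.
    - apply Rinv_le_contravar; lra. }
  split; [assumption |].
  exists (fun s t => m s t * / (sqrt (a s) + sqrt (a t))); split; [| assumption].
  apply approx_mult; [assumption |].
  destruct Hm as [C HC].
  (* The first entry bounds the values. The second bounds the error, in which [m] meets three
     reciprocals of roots, each at most [/ sqrt e]. *)
  exists (Rmax (/ sqrt e) (C * / sqrt e * / sqrt e * / sqrt e)); intros s t Hs Ht.
  pose proof (Hinv s t Hs Ht) as Hi; pose proof (Hinv t t Ht Ht) as Hj.
  replace (sqrt (a t) + sqrt (a t)) with (2 * sqrt (a t)) in Hj by ring.
  pose proof (Rmax_l (/ sqrt e) (C * / sqrt e * / sqrt e * / sqrt e)).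
  split; [rewrite Rabs_pos_eq; lra |]; split; [rewrite Rabs_pos_eq; lra |].
  replace (/ (sqrt (a s) + sqrt (a t)) - / (2 * sqrt (a t)))
    with (- (sqrt (a s) - sqrt (a t)) * / (sqrt (a s) + sqrt (a t)) * / (2 * sqrt (a t)))
    by (field; pose proof (Hs0 s Hs); pose proof (Hs0 t Ht); lra).
  rewrite (Hds s t Hs Ht), !Rabs_mult, Rabs_Ropp, !Rabs_mult.
  rewrite (Rabs_pos_eq (/ (sqrt (a s) + sqrt (a t)))) by lra.
  rewrite (Rabs_pos_eq (/ (2 * sqrt (a t)))) by lra.
  destruct (HC s t Hs Ht) as [HC1 _]; pose proof (Rabs_pos (m s t)).
  pose proof (Rabs_pos (eta s t)).
  replace (Rabs (eta s t) * (Rabs (m s t) * / (sqrt (a s) + sqrt (a t))) *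
    / (sqrt (a s) + sqrt (a t)) * / (2 * sqrt (a t)))
  with (Rabs (m s t) * / (sqrt (a s) + sqrt (a t)) *
    / (sqrt (a s) + sqrt (a t)) * / (2 * sqrt (a t)) * Rabs (eta s t)) by ring.
  apply Rmult_le_compat_r; [assumption |].
  eapply Rle_trans; [| apply Rmax_r].
  assert (forall u v, 0 <= u -> 0 <= v -> 0 <= u * v) by (intros; nra).
  repeat apply Rmult_le_compat; try lra; repeat apply H2; lra.
Qed.

(** * Constancy from a quadratic bound on increments *)

Lemma eq_of_quadratic_bound (X f : R -> R) (a b C : R) :
  continuity X ->
  (forall s t, a < s < b -> a < t < b -> Rabs (f s - f t) <= C * (X s - X t)^2) ->
  forall s t, a < s < b -> a < t < b -> f s = f t.
Proof.
  intros HX Hf s t Hs Ht.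
  (* The intermediate value theorem halves the increment of [X], not that of time. *)
  assert (Hmid : forall s t, a < s < b -> a < t < b ->
    exists r, a < r < b /\ X r = (X s + X t) / 2).
  { clear s t Hs Ht; intros s t Hs Ht.
    destruct (IVT_gen X s t ((X s + X t) / 2) HX) as (r & Hr & HXr).
    - split; [apply Rmin_case_strong | apply Rmax_case_strong]; lra.
    - exists r; split; [| assumption].
      revert Hr; apply Rmin_case_strong; apply Rmax_case_strong; lra. }
  (* A halving replaces one term by two, each with a quarter of the bound, so every round gains a
     factor of one half. *)
  assert (Hk : forall k s t, a < s < b -> a < t < b ->
    Rabs (f s - f t) <= C * (X s - X t)^2 * (/ 2)^k).
  { induction k as [|k IH]; intros s' t' Hs' Ht'.
    - rewrite pow_O, Rmult_1_r; auto.
    - destruct (Hmid s' t' Hs' Ht') as (r & Hr & HXr).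
      pose proof (IH s' r Hs' Hr) as H1; pose proof (IH r t' Hr Ht') as H2.
      rewrite HXr in H1, H2.
      replace (f s' - f t') with ((f s' - f r) + (f r - f t')) by ring.
      eapply Rle_trans; [apply Rabs_triang |].
      eapply Rle_trans; [apply Rplus_le_compat; eassumption |].
      right; simpl; field. }
  assert (H0 : Rabs (f s - f t) = 0).
  { apply Rle_antisym; [| apply Rabs_pos].
    set (K := C * (X s - X t)^2) in *.
    apply Rnot_lt_le; intros Hpos.
    (* [N] makes [(/ 2)^N] smaller than the supposed gap over [Rabs K + 1]; the added 1 avoids a
       division by zero. *)
    destruct (pow_lt_1_zero (/ 2) ltac:(rewrite Rabs_pos_eq; lra)
      (Rabs (f s - f t) / (Rabs K + 1))) as (N & HN).
    { apply Rdiv_lt_0_compat; [assumption |]; pose proof (Rabs_pos K); lra. }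
    specialize (HN N (le_n N)).
    rewrite Rabs_pos_eq in HN by (apply pow_le; lra).
    pose proof (Hk N s t Hs Ht) as Hb; fold K in Hb.
    assert (0 < (/ 2)^N) by (apply pow_lt; lra).
    pose proof (Rle_abs K); pose proof (Rabs_pos K).
    apply (Rmult_lt_compat_l (Rabs K + 1)) in HN; [| lra].
    replace ((Rabs K + 1) * (Rabs (f s - f t) / (Rabs K + 1)))
      with (Rabs (f s - f t)) in HN by (field; lra).
    assert (K * (/2)^N <= (Rabs K + 1) * (/2)^N)
      by (apply Rmult_le_compat_r; lra).
    lra. }
  destruct (Req_dec (f s - f t) 0) as [E | E]; [lra |].
  apply Rabs_no_R0 in E; contradiction.
Qed.

(** A locally constant function has derivative zero everywhere, and the null-derivative criterion
    makes it constant on the whole line. *)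
Lemma locally_constant_constant (f : R -> R) :
  (forall t0, exists del, 0 < del /\ forall s, Rabs (s - t0) < del -> f s = f t0) ->
  forall s t, f s = f t.
Proof.
  intros H.
  assert (Hd : forall x, derivable_pt_lim f x 0).
  { intros x eps Heps; destruct (H x) as (del & Hdel & Hc).
    exists (mkposreal del Hdel); simpl; intros h Hh Hhd.
    rewrite (Hc (x + h)) by (replace (x + h - x) with h by ring; assumption).
    replace ((f x - f x) / h - 0) with 0 by (field; assumption).
    rewrite Rabs_R0; assumption. }
  assert (pr : derivable f) by (intros x; exists 0; apply Hd).
  apply (null_derivative_1 f pr).
  intros x; apply derive_pt_eq; apply Hd.
Qed.

(** * Algebra of a single reflection *)

(** For the symmetric matrix [A] with rows [(a, b)] and [(b, d)], the pair [lin a b x y],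
    [lin b d x y] is the gradient [A u] at [u = (x, y)], and [gsq] is its squared length. *)
Definition lin (a b x y : R) : R := a * x + b * y.
Definition qform (a b d p q : R) : R := a * p * p + 2 * b * p * q + d * q * q.
Definition gsq (a b d x y : R) : R := lin a b x y ^ 2 + lin b d x y ^ 2.
(* [spd] and [rot] are the [s] and [c] of the motion above. *)
Definition spd (a b d x y p q : R) : R := lin a b x y * q - lin b d x y * p.
Definition rot (a b d x y p q : R) : R := (a * d - b * b) * (x * q - y * p).

(** The state of the billiard at the start of a side: a point [u = (x, y)] with a direction
    [w = (p, q)]. The last field is tangency to the caustic; its sign makes [w] point into the
    ellipse. *)
Record ray (a b d J x y p q : R) : Prop := {
  ray_det : 0 < a * d - b * b;
  ray_J : 0 < J;
  ray_ell : qform a b d x y = 1;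
  ray_unit : p * p + q * q = 1;
  ray_inc : lin a b x y * p + lin b d x y * q = - J }.

Section Algebra.
Context (a b d J x y p q : R) (H : ray a b d J x y p q).
(** In the orthonormal frame of [w = (p, q)] and [n = (q, - p)], the matrix [A] has diagonal entries
    [Q], [Z] and off-diagonal entry [T], while the gradient has coordinates [- J] and [s]. The
    section computes in this frame. *)
Let D := a * d - b * b.
Let Q := qform a b d p q.
Let T := lin a b p q * q - lin b d p q * p.
Let Z := a * q * q - 2 * b * p * q + d * p * p.
Let s := spd a b d x y p q.
Let c := rot a b d x y p q.

Lemma frame_det : Q * Z - T * T = D.
Proof.
  destruct H as [_ _ _ Hu _].
  transitivity (D * (p * p + q * q) ^ 2); [| rewrite Hu; ring].
  unfold Q, Z, T, D, qform, lin; ring.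
Qed.

Lemma frame_trace : Q + Z = a + d.
Proof.
  destruct H as [_ _ _ Hu _].
  transitivity ((a + d) * (p * p + q * q)); [| rewrite Hu; ring].
  unfold Q, Z, qform; ring.
Qed.

Lemma frame_grad :
  lin a b x y = - J * p + s * q /\ lin b d x y = - J * q - s * p.
Proof.
  destruct H as [_ _ _ Hu Hi]; unfold s, spd.
  set (g := lin a b x y) in *; set (h := lin b d x y) in *.
  replace J with (- (g * p + h * q)) by lra; split.
  - transitivity (g * (p * p + q * q)); [rewrite Hu |]; ring.
  - transitivity (h * (p * p + q * q)); [rewrite Hu |]; ring.
Qed.

Lemma gsq_frame : gsq a b d x y = J * J + s * s.
Proof.
  destruct H as [_ _ _ Hu _]; destruct frame_grad as [Hg Hh].
  unfold gsq; rewrite Hg, Hh.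
  transitivity ((J * J + s * s) * (p * p + q * q)); [| rewrite Hu]; ring.
Qed.

(** [A] multiplies areas by its determinant, so [c] is the cross product of [A u] and [A w]. *)
Lemma rot_frame : c = J * T + s * Q.
Proof.
  destruct frame_grad as [Hg Hh].
  transitivity (lin a b x y * lin b d p q - lin b d x y * lin a b p q).
  - unfold c, rot, lin; ring.
  - rewrite Hg, Hh; unfold T, Q, qform, lin; ring.
Qed.

(** The equation of the ellipse in terms of the gradient, [g . adj(A) g = D], written in the
    frame. *)
Lemma ell_frame : D = Z * J * J + 2 * T * J * s + Q * s * s.
Proof.
  destruct frame_grad as [Hg Hh]; destruct H as [_ _ He Hu _].
  transitivity (d * lin a b x y ^ 2 - 2 * b * lin a b x y * lin b d x y
    + a * lin b d x y ^ 2).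
  - transitivity (D * qform a b d x y); [rewrite He; ring |].
    unfold D, qform, lin; ring.
  - rewrite Hg, Hh; unfold Z, T, Q, qform, lin; ring.
Qed.

Lemma rot_sq : c * c = D * (Q - J * J).
Proof.
  rewrite rot_frame.
  replace (D * (Q - J * J)) with (Q * D - D * (J * J)) by ring.
  rewrite ell_frame at 1; rewrite <- frame_det; ring.
Qed.

(** The square [c * c] in [rot_sq] is nonnegative. The bound does not depend on the ray, so [Q]
    stays uniformly away from zero when [/ Q] is differentiated. *)
Lemma qform_ge : J * J <= Q.
Proof.
  pose proof rot_sq as Hc; destruct H as [HD _ _ _ _]; fold D in HD.
  pose proof (Rle_0_sqr c) as Hp; unfold Rsqr in Hp.
  apply Rnot_lt_le; intros Hlt.
  assert (D * (Q - J * J) < 0) by nra; lra.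
Qed.

Lemma gsq_ge : J * J <= gsq a b d x y.
Proof. rewrite gsq_frame; nra. Qed.

(** The second point of the ellipse on the ray: along [u + r w] the form equals [1 - 2 J r + Q r^2],
    which is again 1 at [r = 2 J / Q]. *)
Let x1 := x + 2 * J * / Q * p.
Let y1 := y + 2 * J * / Q * q.
Let s1 := spd a b d x1 y1 p q.

Lemma qform_pos : 0 < Q.
Proof. pose proof qform_ge; destruct H; nra. Qed.

Lemma spd_step : s1 = s + 2 * J * / Q * T.
Proof. unfold s1, s, T, x1, y1, spd, lin; ring. Qed.

Lemma inc_step : lin a b x1 y1 * p + lin b d x1 y1 * q = J.
Proof.
  transitivity (lin a b x y * p + lin b d x y * q + 2 * J * / Q * Q).
  - unfold x1, y1, Q, qform, lin; ring.
  - rewrite (ray_inc _ _ _ _ _ _ _ _ H); pose proof qform_pos; field; lra.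
Qed.

Lemma grad_step :
  lin a b x1 y1 = J * p + s1 * q /\ lin b d x1 y1 = J * q - s1 * p.
Proof.
  pose proof inc_step as Hi; pose proof (ray_unit _ _ _ _ _ _ _ _ H) as Hu.
  unfold s1, spd.
  set (g := lin a b x1 y1) in *; set (h := lin b d x1 y1) in *.
  rewrite <- Hi; split.
  - transitivity (g * (p * p + q * q)); [rewrite Hu |]; ring.
  - transitivity (h * (p * p + q * q)); [rewrite Hu |]; ring.
Qed.

(** The left sides are the product rule applied to [u + (2 J / Q) w], with [Q' = - 2 c T] along the
    motion. Hence the next vertex obeys the same law, its speed [s1] being computed from the
    incoming direction. *)
Lemma flow_step :
  - s * lin b d x y + (4 * J * c * T * / Q * / Q * p + 2 * J * / Q * (- c * q))
    = - s1 * lin b d x1 y1 /\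
  s * lin a b x y + (4 * J * c * T * / Q * / Q * q + 2 * J * / Q * (c * p))
    = s1 * lin a b x1 y1.
Proof.
  destruct frame_grad as [-> ->]; destruct grad_step as [-> ->].
  rewrite spd_step, rot_frame; pose proof qform_pos; split; field; lra.
Qed.

(** The gradients are normal to the two tangent lines, so this is, up to sign, the numerator of the
    cosine of the angle between them. *)
Lemma grad_dot_step :
  lin a b x y * lin a b x1 y1 + lin b d x y * lin b d x1 y1
  = (D - J * J * (a + d)) * / Q.
Proof.
  pose proof qform_pos as HQ; pose proof (ray_unit _ _ _ _ _ _ _ _ H) as Hu.
  pose proof ell_frame as He.
  destruct frame_grad as [-> ->]; destruct grad_step as [-> ->].
  transitivity ((s * s1 - J * J) * (p * p + q * q)); [ring | rewrite Hu].
  rewrite spd_step, <- frame_trace, He.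
  field_simplify_eq; [| lra]. ring.
Qed.

(** The left side is half the derivative of [gsq] along the motion. After division by [gsq] the term
    [- J * D] gives the telescoping part, and [Z * J + T * s] combines with its counterpart at the
    other end of the side. *)
Lemma half_logder :
  s * rot a b d x y (lin a b x y) (lin b d x y)
  = gsq a b d x y * (Z * J + T * s) - J * D.
Proof.
  rewrite gsq_frame, ell_frame.
  destruct frame_grad as [Hg Hh].
  transitivity (s * (d * lin a b x y * lin b d x y - b * lin b d x y ^ 2
     - a * lin a b x y * lin b d x y + b * lin a b x y ^ 2)).
  - unfold rot, lin; ring.
  - rewrite Hg, Hh; unfold Z, T, Q, qform, lin; ring.
Qed.

Lemma gsq_step : gsq a b d x1 y1 = J * J + s1 * s1.
Proof.
  pose proof (ray_unit _ _ _ _ _ _ _ _ H) as Hu; destruct grad_step as [Hg Hh].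
  unfold gsq; rewrite Hg, Hh.
  transitivity ((J * J + s1 * s1) * (p * p + q * q)); [| rewrite Hu]; ring.
Qed.

Lemma half_logder_step :
  s1 * rot a b d x1 y1 (lin a b x1 y1) (lin b d x1 y1)
  = gsq a b d x1 y1 * (- Z * J + T * s1) + J * D.
Proof.
  (* This is [ell_frame] with [J] replaced by [- J], as fits the arriving end of the side. *)
  assert (He : D = Z * J * J - 2 * T * J * s1 + Q * s1 * s1).
  { rewrite ell_frame, spd_step; field; pose proof qform_pos; lra. }
  rewrite gsq_step, He.
  destruct grad_step as [Hg Hh].
  transitivity (s1 * (d * lin a b x1 y1 * lin b d x1 y1 - b * lin b d x1 y1 ^ 2
     - a * lin a b x1 y1 * lin b d x1 y1 + b * lin a b x1 y1 ^ 2)).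
  - unfold rot, lin; ring.
  - rewrite Hg, Hh; unfold Z, T, Q, qform, lin; ring.
Qed.

(* The logarithmic derivative of [1 / Q] along the flow, against those of [|g|] at both ends. *)
Lemma logder_step :
  2 * c * T * / Q
  = s * rot a b d x y (lin a b x y) (lin b d x y) * / gsq a b d x y
    + s1 * rot a b d x1 y1 (lin a b x1 y1) (lin b d x1 y1) * / gsq a b d x1 y1
    - J * D * (/ gsq a b d x1 y1 - / gsq a b d x y).
Proof.
  pose proof gsq_ge; pose proof qform_pos; pose proof (ray_J _ _ _ _ _ _ _ _ H).
  assert (0 < J * J) by nra.
  assert (J * J <= gsq a b d x1 y1) by (rewrite gsq_step; nra).
  rewrite half_logder, half_logder_step, rot_frame, spd_step; field; lra.
Qed.
End Algebra.

(** The reflection law [w1 = w - 2 J g / |g|^2] is differentiated along the motion, with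
    [g' = A u']; the outcome is the prescribed rotation of [w1]. *)
Lemma reflect_flow (a b d J x y p q : R) :
  let g := lin a b x y in let h := lin b d x y in
  let s := spd a b d x y p q in let c := rot a b d x y p q in
  let B := gsq a b d x y in
  let p1 := p + - 2 * J * (g * / B) in let q1 := q + - 2 * J * (h * / B) in
  let g' := a * (- s * h) + b * (s * g) in let h' := b * (- s * h) + d * (s * g) in
  let B' := 2 * (g * g' + h * h') in
  p * p + q * q = 1 -> g * p + h * q = J -> 0 < B ->
  - c * q + - 2 * J * (g' * / B + g * (- B' * / B * / B)) = - rot a b d x y p1 q1 * q1 /\
  c * p + - 2 * J * (h' * / B + h * (- B' * / B * / B)) = rot a b d x y p1 q1 * p1.
Proof.
  intros g h s c B p1 q1 g' h' B' Hu HJ HB.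
  assert (EB : B = g * g + h * h) by (unfold B, gsq; fold g h; ring).
  assert (Hs : s = g * q - h * p) by reflexivity.
  (* [w] is recovered from its components along the gradient and the tangent. *)
  assert (Ep : p = (J * g - s * h) * / B).
  { rewrite <- HJ, Hs, EB; field; lra. }
  assert (Eq : q = (J * h + s * g) * / B).
  { rewrite <- HJ, Hs, EB; field; lra. }
  (* [D u = adj(A) g] eliminates [u]; what is left is rational in [g], [h], [s], [J] and the entries
     of [A]. *)
  assert (Er : forall p q, rot a b d x y p q = (d * g - b * h) * q - (a * h - b * g) * p)
    by (intros; unfold rot, g, h, lin; ring).
  unfold c, B'; rewrite !Er; unfold g', h', p1, q1.
  clearbody g h s; clear Hs HJ Hu.
  rewrite Ep, Eq, EB in *; split; field; lra.
Qed.

(** Reflection reverses the component along the gradient and keeps the tangential one, and the two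
    components determine the vector. *)
Lemma reflect_dir (a b d J x y p q p1 q1 : R) :
  let g := lin a b x y in let h := lin b d x y in
  p * p + q * q = 1 -> p1 * p1 + q1 * q1 = 1 ->
  g * p + h * q = J -> g * p1 + h * q1 = - J ->
  spd a b d x y p q = spd a b d x y p1 q1 -> 0 < gsq a b d x y ->
  p1 = p + - 2 * J * (g * / gsq a b d x y) /\ q1 = q + - 2 * J * (h * / gsq a b d x y).
Proof.
  intros g h Hu Hu1 HJ HJ1 Hs HB.
  assert (EB : gsq a b d x y = g * g + h * h) by (unfold gsq; fold g h; ring).
  unfold spd in Hs; fold g h in Hs; rewrite EB in *.
  split.
  - apply (Rmult_eq_reg_l (g * g + h * h)); [| lra].
    transitivity (g * (g * p1 + h * q1) - h * (g * q1 - h * p1)); [ring |].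
    rewrite HJ1, <- Hs, <- HJ; field; lra.
  - apply (Rmult_eq_reg_l (g * g + h * h)); [| lra].
    transitivity (h * (g * p1 + h * q1) + g * (g * q1 - h * p1)); [ring |].
    rewrite HJ1, <- Hs, <- HJ; field; lra.
Qed.

(** * The flow commutes with the billiard map *)

Definition flows (U : R -> Prop) (eta : R -> R -> R) (a b d : R)
    (x y p q : R -> R) : Prop :=
  let s t := spd a b d (x t) (y t) (p t) (q t) in
  let c t := rot a b d (x t) (y t) (p t) (q t) in
  cder U eta x (fun t => - s t * lin b d (x t) (y t)) /\
  cder U eta y (fun t => s t * lin a b (x t) (y t)) /\
  cder U eta p (fun t => - c t * q t) /\
  cder U eta q (fun t => c t * p t).

Lemma cder_lin U eta a b x x' y y' :
  cder U eta x x' -> cder U eta y y' ->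
  cder U eta (fun t => lin a b (x t) (y t)) (fun t => lin a b (x' t) (y' t)).
Proof. intros Hx Hy; apply cder_plus; now apply cder_scal. Qed.

(** The speed [s] is left free because at a new vertex it is first known through the incoming
    direction. *)
Lemma cder_gsq U eta a b d x y s :
  cder U eta x (fun t => - s t * lin b d (x t) (y t)) ->
  cder U eta y (fun t => s t * lin a b (x t) (y t)) ->
  cder U eta (fun t => gsq a b d (x t) (y t))
    (fun t => 2 * (s t * rot a b d (x t) (y t) (lin a b (x t) (y t)) (lin b d (x t) (y t)))).
Proof.
  intros Hx Hy.
  pose proof (cder_lin _ _ a b _ _ _ _ Hx Hy) as Hg.
  pose proof (cder_lin _ _ b d _ _ _ _ Hx Hy) as Hh.
  eapply cder_ext.
  - exact (cder_plus _ _ _ _ _ _ (cder_mult _ _ _ _ _ _ Hg Hg) (cder_mult _ _ _ _ _ _ Hh Hh)).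
  - intros t _; unfold gsq; simpl; ring.
  - intros t _; unfold rot, lin; simpl; ring.
Qed.

(** The vertex is transported along the side by [flow_step], then the direction is reflected by
    [reflect_flow]. Equality of the tangential components lets the outgoing direction replace the
    incoming one in the speed. *)
Lemma flows_step U eta a b d J x y p q x1 y1 p1 q1 :
  0 < J -> flows U eta a b d x y p q ->
  (forall t, U t -> ray a b d J (x t) (y t) (p t) (q t)) ->
  (forall t, U t -> ray a b d J (x1 t) (y1 t) (p1 t) (q1 t)) ->
  (forall t, U t -> x1 t = x t + 2 * J * / qform a b d (p t) (q t) * p t) ->
  (forall t, U t -> y1 t = y t + 2 * J * / qform a b d (p t) (q t) * q t) ->
  (forall t, U t -> spd a b d (x1 t) (y1 t) (p t) (q t)
                  = spd a b d (x1 t) (y1 t) (p1 t) (q1 t)) ->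
  cder U eta (fun t => / qform a b d (p t) (q t))
    (fun t => 2 * rot a b d (x t) (y t) (p t) (q t)
      * (lin a b (p t) (q t) * q t - lin b d (p t) (q t) * p t)
      * / qform a b d (p t) (q t) * / qform a b d (p t) (q t)) /\
  flows U eta a b d x1 y1 p1 q1.
Proof.
  intros HJ (Fx & Fy & Fp & Fq) Hr Hr1 Hx1 Hy1 Hs1.
  assert (HJJ : 0 < J * J) by nra.
  assert (HQ : cder U eta (fun t => / qform a b d (p t) (q t))
    (fun t => 2 * rot a b d (x t) (y t) (p t) (q t)
      * (lin a b (p t) (q t) * q t - lin b d (p t) (q t) * p t)
      * / qform a b d (p t) (q t) * / qform a b d (p t) (q t))).
  { eapply cder_ext.
    - eapply (cder_inv U eta (fun t => qform a b d (p t) (q t)) _ (J * J)).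
      + eapply cder_ext.
        * exact (cder_plus _ _ _ _ _ _
            (cder_mult _ _ _ _ _ _ Fp (cder_lin _ _ a b _ _ _ _ Fp Fq))
            (cder_mult _ _ _ _ _ _ Fq (cder_lin _ _ b d _ _ _ _ Fp Fq))).
        * intros t _; unfold qform, lin; ring.
        * reflexivity.
      + assumption.
      + intros t Ht; exact (qform_ge _ _ _ _ _ _ _ _ (Hr t Ht)).
    - reflexivity.
    - intros t _; cbv beta; unfold lin; ring. }
  split; [exact HQ |].
  assert (HL := cder_scal _ _ (2 * J) _ _ HQ).
  assert (Fx1 : cder U eta x1 (fun t => - spd a b d (x1 t) (y1 t) (p t) (q t)
                                        * lin b d (x1 t) (y1 t))).
  { eapply cder_ext.
    - exact (cder_plus _ _ _ _ _ _ Fx (cder_mult _ _ _ _ _ _ HL Fp)).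
    - intros t Ht; cbv beta; now rewrite Hx1.
    - intros t Ht; cbv beta; rewrite Hx1, Hy1 by assumption.
      rewrite <- (proj1 (flow_step _ _ _ _ _ _ _ _ (Hr t Ht))); ring. }
  assert (Fy1 : cder U eta y1 (fun t => spd a b d (x1 t) (y1 t) (p t) (q t)
                                        * lin a b (x1 t) (y1 t))).
  { eapply cder_ext.
    - exact (cder_plus _ _ _ _ _ _ Fy (cder_mult _ _ _ _ _ _ HL Fq)).
    - intros t Ht; cbv beta; now rewrite Hy1.
    - intros t Ht; cbv beta; rewrite Hx1, Hy1 by assumption.
      rewrite <- (proj2 (flow_step _ _ _ _ _ _ _ _ (Hr t Ht))); ring. }
  (* Adding a multiple of [w] to [u] leaves their cross product unchanged. *)
  assert (Erot : forall t, U t -> rot a b d (x t) (y t) (p t) (q t)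
     = rot a b d (x1 t) (y1 t) (p t) (q t)).
  { intros t Ht; rewrite Hx1, Hy1 by assumption; unfold rot; ring. }
  assert (Hinc : forall t, U t ->
    lin a b (x1 t) (y1 t) * p t + lin b d (x1 t) (y1 t) * q t = J).
  { intros t Ht; rewrite Hx1, Hy1 by assumption.
    exact (inc_step _ _ _ _ _ _ _ _ (Hr t Ht)). }
  assert (HB : forall t, U t -> J * J <= gsq a b d (x1 t) (y1 t))
    by (intros t Ht; exact (gsq_ge _ _ _ _ _ _ _ _ (Hr1 t Ht))).
  assert (HBi := cder_inv _ _ _ _ _ (cder_gsq _ _ _ _ _ _ _ _ Fx1 Fy1) HJJ HB).
  assert (Hg := cder_lin _ _ a b _ _ _ _ Fx1 Fy1).
  assert (Hh := cder_lin _ _ b d _ _ _ _ Fx1 Fy1).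
  assert (Hdir : forall t, U t ->
    p1 t = p t + - 2 * J * (lin a b (x1 t) (y1 t) * / gsq a b d (x1 t) (y1 t)) /\
    q1 t = q t + - 2 * J * (lin b d (x1 t) (y1 t) * / gsq a b d (x1 t) (y1 t))).
  { intros t Ht; apply reflect_dir.
    - exact (ray_unit _ _ _ _ _ _ _ _ (Hr t Ht)).
    - exact (ray_unit _ _ _ _ _ _ _ _ (Hr1 t Ht)).
    - auto.
    - exact (ray_inc _ _ _ _ _ _ _ _ (Hr1 t Ht)).
    - auto.
    - pose proof (HB t Ht); lra. }
  assert (Hfl := fun t Ht => reflect_flow a b d J (x1 t) (y1 t) (p t) (q t)
     (ray_unit _ _ _ _ _ _ _ _ (Hr t Ht)) (Hinc t Ht)
     (Rlt_le_trans _ _ _ HJJ (HB t Ht))).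
  cbv zeta in Hfl.
  split; [| split; [| split]].
  - eapply cder_ext; [exact Fx1 | reflexivity |].
    intros t Ht; cbv beta; now rewrite Hs1.
  - eapply cder_ext; [exact Fy1 | reflexivity |].
    intros t Ht; cbv beta; now rewrite Hs1.
  - eapply cder_ext.
    + exact (cder_plus _ _ _ _ _ _ Fp
        (cder_scal _ _ (- 2 * J) _ _ (cder_mult _ _ _ _ _ _ Hg HBi))).
    + intros t Ht; cbv beta; symmetry; apply Hdir, Ht.
    + intros t Ht; destruct (Hdir t Ht) as [-> ->].
      rewrite <- (proj1 (Hfl t Ht)), (Erot t Ht).
      unfold rot, lin; ring.
  - eapply cder_ext.
    + exact (cder_plus _ _ _ _ _ _ Fq
        (cder_scal _ _ (- 2 * J) _ _ (cder_mult _ _ _ _ _ _ Hh HBi))).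
    + intros t Ht; cbv beta; symmetry; apply Hdir, Ht.
    + intros t Ht; destruct (Hdir t Ht) as [-> ->].
      rewrite <- (proj2 (Hfl t Ht)), (Erot t Ht).
      unfold rot, lin; ring.
Qed.

Lemma cder_factor U eta a b d J x y p q x1 y1 p1 q1 :
  0 < J -> flows U eta a b d x y p q ->
  (forall t, U t -> ray a b d J (x t) (y t) (p t) (q t)) ->
  (forall t, U t -> ray a b d J (x1 t) (y1 t) (p1 t) (q1 t)) ->
  (forall t, U t -> x1 t = x t + 2 * J * / qform a b d (p t) (q t) * p t) ->
  (forall t, U t -> y1 t = y t + 2 * J * / qform a b d (p t) (q t) * q t) ->
  (forall t, U t -> spd a b d (x1 t) (y1 t) (p t) (q t)
                  = spd a b d (x1 t) (y1 t) (p1 t) (q1 t)) ->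
  let f t := / qform a b d (p t) (q t) *
    (/ sqrt (gsq a b d (x t) (y t)) * / sqrt (gsq a b d (x1 t) (y1 t))) in
  cder U eta f (fun t => f t * (J * (a * d - b * b) *
    (/ gsq a b d (x t) (y t) - / gsq a b d (x1 t) (y1 t)))).
Proof.
  intros HJ F Hr Hr1 Hx1 Hy1 Hs1 f.
  destruct (flows_step _ _ _ _ _ _ _ _ _ _ _ _ _ _ HJ F Hr Hr1 Hx1 Hy1 Hs1)
    as [HQ (Fx1 & Fy1 & _ & _)].
  destruct F as (Fx & Fy & _ & _).
  assert (HJJ : 0 < J * J) by nra.
  assert (HB : forall t, U t -> J * J <= gsq a b d (x t) (y t))
    by (intros t Ht; exact (gsq_ge _ _ _ _ _ _ _ _ (Hr t Ht))).
  assert (HB1 : forall t, U t -> J * J <= gsq a b d (x1 t) (y1 t))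
    by (intros t Ht; exact (gsq_ge _ _ _ _ _ _ _ _ (Hr1 t Ht))).
  assert (Hsq : 0 < sqrt (J * J)) by now apply sqrt_lt_R0.
  assert (Hn := cder_inv _ _ _ _ _ (cder_sqrt _ _ _ _ _ (cder_gsq _ _ _ _ _ _ _ _ Fx Fy) HJJ HB)
    Hsq (fun t Ht => sqrt_le_1_alt _ _ (HB t Ht))).
  assert (Hn1 := cder_inv _ _ _ _ _ (cder_sqrt _ _ _ _ _ (cder_gsq _ _ _ _ _ _ _ _ Fx1 Fy1) HJJ HB1)
    Hsq (fun t Ht => sqrt_le_1_alt _ _ (HB1 t Ht))).
  eapply cder_ext.
  - exact (cder_mult _ _ _ _ _ _ HQ (cder_mult _ _ _ _ _ _ Hn Hn1)).
  - reflexivity.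
  - intros t Ht; cbv beta; unfold f.
    assert (Hld := logder_step _ _ _ _ _ _ _ _ (Hr t Ht)).
    cbv zeta in Hld; rewrite <- Hx1, <- Hy1 in Hld by assumption.
    rewrite (Hs1 t Ht) in Hld.
    pose proof (HB t Ht) as Bp; pose proof (HB1 t Ht) as Bp1.
    pose proof (qform_ge _ _ _ _ _ _ _ _ (Hr t Ht)) as Qp.
    set (s := spd a b d (x t) (y t) (p t) (q t)) in *.
    set (s1 := spd a b d (x1 t) (y1 t) (p1 t) (q1 t)) in *.
    set (r := rot a b d (x t) (y t) (lin a b (x t) (y t)) (lin b d (x t) (y t))) in *.
    set (r1 := rot a b d (x1 t) (y1 t) (lin a b (x1 t) (y1 t)) (lin b d (x1 t) (y1 t))) in *.
    set (c := rot a b d (x t) (y t) (p t) (q t)) in *.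
    set (Q := qform a b d (p t) (q t)) in *.
    set (B := gsq a b d (x t) (y t)) in *.
    set (B1 := gsq a b d (x1 t) (y1 t)) in *.
    set (T := lin a b (p t) (q t) * q t - lin b d (p t) (q t) * p t) in *.
    assert (Hb : 0 < sqrt B) by (apply sqrt_lt_R0; lra).
    assert (Hb1 : 0 < sqrt B1) by (apply sqrt_lt_R0; lra).
    assert (Eb : B = sqrt B * sqrt B) by (symmetry; apply sqrt_sqrt; lra).
    assert (Eb1 : B1 = sqrt B1 * sqrt B1) by (symmetry; apply sqrt_sqrt; lra).
    (* [logder_step] is put in the form in which the three derivatives of the product rule
       appear. *)
    replace (J * (a * d - b * b) * (/ B - / B1))
      with (2 * c * T * / Q - s * r * / B - s1 * r1 * / B1)
      by (rewrite Hld; ring).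
    replace (s * r * / B) with (s * r * / sqrt B * / sqrt B)
      by (rewrite Eb at 3; field; lra).
    replace (s1 * r1 * / B1) with (s1 * r1 * / sqrt B1 * / sqrt B1)
      by (rewrite Eb1 at 3; field; lra).
    field; lra.
Qed.

(** * Cyclic indices and the product around the polygon *)

Lemma nxt_lt n i : (0 < n)%nat -> (nxt n i < n)%nat.
Proof. intros; unfold nxt; apply Nat.mod_upper_bound; lia. Qed.

Lemma nxt_succ n i : (S i < n)%nat -> nxt n i = S i.
Proof. intros; unfold nxt; rewrite Nat.mod_small; lia. Qed.

Lemma nxt_last n : nxt (S n) n = 0%nat.
Proof. unfold nxt; replace (n + 1)%nat with (S n) by lia; apply Nat.Div0.mod_same. Qed.

Lemma prv_succ n i : (S i < n)%nat -> prv n (S i) = i.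
Proof.
  intros; unfold prv; replace (S i + n - 1)%nat with (i + 1 * n)%nat by lia.
  rewrite Nat.Div0.mod_add; apply Nat.mod_small; lia.
Qed.

Lemma prv_nxt n i : (i < n)%nat -> prv n (nxt n i) = i.
Proof.
  intros Hi; destruct (Nat.eq_dec (S i) n) as [E | E].
  - subst n; rewrite nxt_last; unfold prv; replace (0 + S i - 1)%nat with i by lia.
    apply Nat.mod_small; lia.
  - rewrite nxt_succ, prv_succ by lia; reflexivity.
Qed.

Lemma prodR_ext n f g : (forall i, (i < n)%nat -> f i = g i) -> prodR n f = prodR n g.
Proof.
  induction n as [|n IH]; intros H; simpl; [reflexivity |].
  rewrite IH, H by auto; reflexivity.
Qed.

Lemma prodR_scal n k f : prodR n (fun i => k * f i) = k ^ n * prodR n f.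
Proof. induction n as [|n IH]; simpl; [ring | rewrite IH; ring]. Qed.

(** Ray [i] meets the ellipse again at the next vertex, and the last clause is the law of reflection
    there, as equality of tangential components. *)
Definition bounces (a b d J : R) (n : nat) (x y p q : nat -> R) : Prop :=
  forall i, (i < n)%nat ->
    ray a b d J (x i) (y i) (p i) (q i) /\
    x (nxt n i) = x i + 2 * J * / qform a b d (p i) (q i) * p i /\
    y (nxt n i) = y i + 2 * J * / qform a b d (p i) (q i) * q i /\
    spd a b d (x (nxt n i)) (y (nxt n i)) (p i) (q i)
      = spd a b d (x (nxt n i)) (y (nxt n i)) (p (nxt n i)) (q (nxt n i)).

(** Equal to the cosine of [beta] up to a constant depending only on the ellipse and [J]. *)
Definition factor (a b d : R) (n : nat) (x y p q : nat -> R) (i : nat) : R :=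
  / qform a b d (p i) (q i) *
  (/ sqrt (gsq a b d (x i) (y i)) * / sqrt (gsq a b d (x (nxt n i)) (y (nxt n i)))).

Lemma cder_prod_factor U eta a b d J n (x y p q : R -> nat -> R) :
  0 < J -> (0 < n)%nat ->
  (forall t, U t -> bounces a b d J n (x t) (y t) (p t) (q t)) ->
  flows U eta a b d (fun t => x t 0%nat) (fun t => y t 0%nat)
    (fun t => p t 0%nat) (fun t => q t 0%nat) ->
  cder U eta (fun t => prodR n (factor a b d n (x t) (y t) (p t) (q t))) (fun _ => 0).
Proof.
  intros HJ Hn Hb F0.
  (* The motion is given at vertex 0 and carried from side to side. *)
  assert (F : forall i, (i < n)%nat ->
    flows U eta a b d (fun t => x t i) (fun t => y t i) (fun t => p t i) (fun t => q t i)).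
  { induction i as [|i IH]; intros Hi; [exact F0 |].
    assert (Hi' : (i < n)%nat) by lia.
    refine (proj2 (flows_step U eta a b d J _ _ _ _ _ _ _ _ HJ (IH Hi') _ _ _ _ _));
      intros t Ht; destruct (Hb t Ht i Hi') as (H1 & H2 & H3 & H4);
      rewrite (nxt_succ n i Hi) in *; try assumption.
    apply (Hb t Ht (S i) Hi). }
  set (h := fun t i => J * (a * d - b * b) * / gsq a b d (x t i) (y t i)).
  assert (Ff : forall i, (i < n)%nat ->
    cder U eta (fun t => factor a b d n (x t) (y t) (p t) (q t) i)
      (fun t => factor a b d n (x t) (y t) (p t) (q t) i * (h t i - h t (nxt n i)))).
  { intros i Hi; pose proof (nxt_lt n i Hn) as Hj.
    eapply cder_ext.
    - apply (cder_factor U eta a b d J (fun t => x t i) (fun t => y t i)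
        (fun t => p t i) (fun t => q t i) (fun t => x t (nxt n i)) (fun t => y t (nxt n i))
        (fun t => p t (nxt n i)) (fun t => q t (nxt n i)) HJ (F i Hi));
      intros t Ht; destruct (Hb t Ht i Hi) as (H1 & H2 & H3 & H4); try assumption.
      apply (Hb t Ht _ Hj).
    - reflexivity.
    - intros t _; unfold factor, h; ring. }
  (* Partial products telescope to [h] at 0 minus [h] at [m]. The last factor, whose next index is
     0, is treated separately below and cancels what remains. *)
  assert (Fm : forall m, (m < n)%nat ->
    cder U eta (fun t => prodR m (factor a b d n (x t) (y t) (p t) (q t)))
      (fun t => prodR m (factor a b d n (x t) (y t) (p t) (q t)) * (h t 0%nat - h t m))).
  { induction m as [|m IH]; intros Hm.
    - eapply cder_ext; [apply (cder_const U eta 1) | reflexivity | intros; simpl; ring].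
    - eapply cder_ext; [exact (cder_mult _ _ _ _ _ _ (IH ltac:(lia)) (Ff m ltac:(lia)))
        | reflexivity |].
      intros t _; cbv beta; rewrite (nxt_succ n m Hm); simpl; ring. }
  destruct n as [|n]; [lia |].
  eapply cder_ext;
    [exact (cder_mult _ _ _ _ _ _ (Fm n ltac:(lia)) (Ff n ltac:(lia))) | reflexivity |].
  intros t _; cbv beta; rewrite nxt_last; ring.
Qed.

(** * Two-point increments of a continuous family of rays *)

Lemma continuous_pair_pos (f : R * R -> R) (t0 : R) :
  continuous f (t0, t0) -> 0 < f (t0, t0) ->
  exists del, 0 < del /\ forall s t, Rabs (s - t0) < del -> Rabs (t - t0) < del ->
    f (t0, t0) / 2 < f (s, t).
Proof.
  intros Hc Hp.
  destruct (proj1 (filterlim_locally _ _) Hc (mkposreal (f (t0, t0) / 2) ltac:(lra)))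
    as (del & Hdel).
  exists del; split; [apply cond_pos |]; intros s t Hs Ht.
  specialize (Hdel (s, t)).
  assert (Hb : ball (t0, t0) del (s, t)) by (split; assumption).
  specialize (Hdel Hb); change (Rabs (f (s, t) - f (t0, t0)) < f (t0, t0) / 2) in Hdel.
  apply Rabs_def2 in Hdel; lra.
Qed.

Lemma continuous_mean (x : R -> R) (t0 : R) :
  continuity_pt x t0 ->
  continuous (fun z : R * R => (x (fst z) + x (snd z)) * / 2) (t0, t0).
Proof.
  intros Hx; apply continuity_pt_filterlim in Hx.
  apply (continuous_mult (K := R_AbsRing) (fun z : R * R => x (fst z) + x (snd z)) (fun _ => / 2));
    [| apply continuous_const].
  apply (continuous_plus (K := R_AbsRing) (V := R_NormedModule)
    (fun z : R * R => x (fst z)) (fun z : R * R => x (snd z))).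
  - apply (continuous_comp fst x); [apply continuous_fst | exact Hx].
  - apply (continuous_comp snd x); [apply continuous_snd | exact Hx].
Qed.

Lemma continuous_add {T : UniformSpace} (f g : T -> R) (z : T) :
  continuous f z -> continuous g z -> continuous (fun z => f z + g z) z.
Proof. exact (continuous_plus (K := R_AbsRing) (V := R_NormedModule) f g z). Qed.

Lemma continuous_mul {T : UniformSpace} (f g : T -> R) (z : T) :
  continuous f z -> continuous g z -> continuous (fun z => f z * g z) z.
Proof. exact (continuous_mult (K := R_AbsRing) f g z). Qed.

Lemma continuous_neg {T : UniformSpace} (f : T -> R) (z : T) :
  continuous f z -> continuous (fun z => - f z) z.
Proof. exact (continuous_opp (K := R_AbsRing) (V := R_NormedModule) f z). Qed.

Lemma bounded_near (x : R -> R) (t0 : R) :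
  continuity_pt x t0 ->
  exists del, 0 < del /\ bounded_on (fun t => Rabs (t - t0) < del) x.
Proof.
  intros Hx; destruct (Hx 1 Rlt_0_1) as (del & Hdel & Hc).
  exists del; split; [assumption |]; exists (Rabs (x t0) + 1); intros t Ht.
  destruct (Req_dec t t0) as [-> | Hne]; [lra |].
  assert (H : Rabs (x t - x t0) < 1).
  { apply Hc; repeat split; [exact (not_eq_sym Hne) | assumption]. }
  replace (x t) with ((x t - x t0) + x t0) by ring.
  eapply Rle_trans; [apply Rabs_triang | lra].
Qed.

Lemma approx_mean U eta x :
  bounded_on U x -> approx U eta (fun s _ => x s) x ->
  approx U eta (fun s t => (x s + x t) * / 2) x.
Proof.
  intros Hb Hl.
  eapply approx_ext.
  - exact (approx_mult _ _ _ _ _ _ (approx_plus _ _ _ _ _ _ Hl (approx_right U eta x Hb))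
      (approx_const U eta (/ 2))).
  - reflexivity.
  - intros t _; cbv beta; field.
Qed.

Lemma approx_opp U eta m l :
  approx U eta m l -> approx U eta (fun s t => - m s t) (fun t => - l t).
Proof.
  intros H; eapply approx_ext; [exact (approx_mult _ _ _ _ _ _ (approx_const U eta (-1)) H) | |];
    intros; cbv beta; ring.
Qed.

Lemma approx_lin U eta a b m1 l1 m2 l2 :
  approx U eta m1 l1 -> approx U eta m2 l2 ->
  approx U eta (fun s t => lin a b (m1 s t) (m2 s t)) (fun t => lin a b (l1 t) (l2 t)).
Proof.
  intros H1 H2; apply approx_plus; apply approx_mult; try apply approx_const; assumption.
Qed.

Lemma approx_cross U eta m1 l1 m2 l2 m3 l3 m4 l4 :
  approx U eta m1 l1 -> approx U eta m2 l2 -> approx U eta m3 l3 -> approx U eta m4 l4 ->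
  approx U eta (fun s t => m1 s t * m4 s t - m2 s t * m3 s t)
    (fun t => l1 t * l4 t - l2 t * l3 t).
Proof.
  intros H1 H2 H3 H4; apply approx_plus; [now apply approx_mult |].
  apply approx_opp; now apply approx_mult.
Qed.

Definition mean (x : R -> R) (s t : R) : R := (x s + x t) * / 2.

Lemma approx_field U eta a b d x y p q :
  approx U eta (mean x) x -> approx U eta (mean y) y ->
  approx U eta (mean p) p -> approx U eta (mean q) q ->
  let S s t := spd a b d (mean x s t) (mean y s t) (mean p s t) (mean q s t) in
  let C s t := rot a b d (mean x s t) (mean y s t) (mean p s t) (mean q s t) in
  let s t := spd a b d (x t) (y t) (p t) (q t) in
  let c t := rot a b d (x t) (y t) (p t) (q t) in
  approx U eta (fun u t => - S u t * lin b d (mean x u t) (mean y u t))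
    (fun t => - s t * lin b d (x t) (y t)) /\
  approx U eta (fun u t => S u t * lin a b (mean x u t) (mean y u t))
    (fun t => s t * lin a b (x t) (y t)) /\
  approx U eta (fun u t => - C u t * mean q u t) (fun t => - c t * q t) /\
  approx U eta (fun u t => C u t * mean p u t) (fun t => c t * p t).
Proof.
  intros Hx Hy Hp Hq S C s c.
  assert (Hg := approx_lin _ _ a b _ _ _ _ Hx Hy).
  assert (Hh := approx_lin _ _ b d _ _ _ _ Hx Hy).
  assert (HS : approx U eta S s) by exact (approx_cross _ _ _ _ _ _ _ _ _ _ Hg Hh Hp Hq).
  assert (HC : approx U eta C c)
    by exact (approx_mult _ _ _ _ _ _ (approx_const U eta (a * d - b * b))
      (approx_cross _ _ _ _ _ _ _ _ _ _ Hx Hy Hp Hq)).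
  split; [| split; [| split]].
  - exact (approx_mult _ _ _ _ _ _ (approx_opp _ _ _ _ HS) Hh).
  - exact (approx_mult _ _ _ _ _ _ HS Hg).
  - exact (approx_mult _ _ _ _ _ _ (approx_opp _ _ _ _ HC) Hq).
  - exact (approx_mult _ _ _ _ _ _ HC Hp).
Qed.

(** The difference quotients are exactly the vector field at midpoints, so only the distance from
    the midpoint field to the field at [t] has to be estimated. *)
Lemma flows_of_increments U eta a b d x y p q :
  bounded_on U x -> bounded_on U y -> bounded_on U p -> bounded_on U q ->
  let S s t := spd a b d (mean x s t) (mean y s t) (mean p s t) (mean q s t) in
  let C s t := rot a b d (mean x s t) (mean y s t) (mean p s t) (mean q s t) in
  (forall s t, U s -> U t ->
     x s - x t = eta s t * (- S s t * lin b d (mean x s t) (mean y s t)) /\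
     y s - y t = eta s t * (S s t * lin a b (mean x s t) (mean y s t)) /\
     p s - p t = eta s t * (- C s t * mean q s t) /\
     q s - q t = eta s t * (C s t * mean p s t)) ->
  flows U eta a b d x y p q.
Proof.
  intros Bx By Bp Bq S C Hd.
  (* With [eta = 1], [approx] only says "bounded", which first bounds the difference
     quotients. *)
  assert (Hone : forall z, bounded_on U z -> approx U (fun _ _ => 1) (mean z) z).
  { intros z Bz; apply approx_mean; [assumption |].
    destruct Bz as [K HK].
    apply (approx_left U (fun _ _ => 1) z (fun s t => z s - z t) (K + K));
      [exists K; assumption | intros; ring |].
    intros s t Hs Ht; pose proof (HK s Hs); pose proof (HK t Ht).
    eapply Rle_trans; [apply Rabs_triang |]; rewrite Rabs_Ropp; lra. }
  destruct (approx_field U _ a b d x y p q (Hone x Bx) (Hone y By) (Hone p Bp) (Hone q Bq))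
    as ([K1 H1] & [K2 H2] & [K3 H3] & [K4 H4]).
  destruct (approx_field U eta a b d x y p q) as (A1 & A2 & A3 & A4).
  - apply approx_mean; [assumption |].
    exact (approx_left U eta x _ K1 Bx
      (fun s t Hs Ht => proj1 (Hd s t Hs Ht))
      (fun s t Hs Ht => proj1 (H1 s t Hs Ht))).
  - apply approx_mean; [assumption |].
    exact (approx_left U eta y _ K2 By
      (fun s t Hs Ht => proj1 (proj2 (Hd s t Hs Ht)))
      (fun s t Hs Ht => proj1 (H2 s t Hs Ht))).
  - apply approx_mean; [assumption |].
    exact (approx_left U eta p _ K3 Bp
      (fun s t Hs Ht => proj1 (proj2 (proj2 (Hd s t Hs Ht))))
      (fun s t Hs Ht => proj1 (H3 s t Hs Ht))).
  - apply approx_mean; [assumption |].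
    exact (approx_left U eta q _ K4 Bq
      (fun s t Hs Ht => proj2 (proj2 (proj2 (Hd s t Hs Ht))))
      (fun s t Hs Ht => proj1 (H4 s t Hs Ht))).
  - split; [| split; [| split]]; (split; [assumption |]); eexists;
      (split; [eassumption | intros s t Hs Ht; apply (Hd s t Hs Ht)]).
Qed.

(** The increment of [u] has a coefficient along the quarter turn of the midpoint gradient, that of
    [w] one along the quarter turn of the midpoint direction. This is the pair of coefficients
    projected orthogonally onto [(S, C)]. *)
Definition slope (a b d x y p q x1 y1 p1 q1 : R) : R :=
  let X := (x + x1) * / 2 in let Y := (y + y1) * / 2 in
  let P := (p + p1) * / 2 in let Q := (q + q1) * / 2 in
  let g := lin a b X Y in let h := lin b d X Y in
  let S := spd a b d X Y P Q in let C := rot a b d X Y P Q in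
  ((g * (y - y1) - h * (x - x1)) * / (g * g + h * h) * S
   + (P * (q - q1) - Q * (p - p1)) * / (P * P + Q * Q) * C) * / (S * S + C * C).

(* The increments of [qform u = 1], [|w| = 1] and [g . w = - J] factor exactly
   through the midpoints. *)
Lemma slope_spec a b d J x y p q x1 y1 p1 q1 :
  let X := (x + x1) * / 2 in let Y := (y + y1) * / 2 in
  let P := (p + p1) * / 2 in let Q := (q + q1) * / 2 in
  let g := lin a b X Y in let h := lin b d X Y in
  let S := spd a b d X Y P Q in let C := rot a b d X Y P Q in
  let eta := slope a b d x y p q x1 y1 p1 q1 in
  ray a b d J x y p q -> ray a b d J x1 y1 p1 q1 ->
  0 < g * g + h * h -> 0 < P * P + Q * Q -> 0 < S * S + C * C ->
  x - x1 = eta * (- S * h) /\ y - y1 = eta * (S * g) /\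
  p - p1 = eta * (- C * Q) /\ q - q1 = eta * (C * P).
Proof.
  intros X Y P Q g h S C eta [_ _ He Hu Hi] [_ _ He1 Hu1 Hi1] Hg HP HS.
  unfold eta, slope; fold X Y P Q; fold g h S C.
  set (ga := (g * (y - y1) - h * (x - x1)) * / (g * g + h * h)).
  set (al := (P * (q - q1) - Q * (p - p1)) * / (P * P + Q * Q)).
  assert (E1 : g * (x - x1) + h * (y - y1) = 0).
  { transitivity ((qform a b d x y - qform a b d x1 y1) * / 2); [| rewrite He, He1; ring].
    unfold g, h, X, Y, lin, qform; field. }
  assert (E2 : P * (p - p1) + Q * (q - q1) = 0).
  { transitivity (((p * p + q * q) - (p1 * p1 + q1 * q1)) * / 2); [| rewrite Hu, Hu1; ring].
    unfold P, Q; field. }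
  assert (E3 : lin a b (x - x1) (y - y1) * P + lin b d (x - x1) (y - y1) * Q
     + g * (p - p1) + h * (q - q1) = 0).
  { transitivity ((lin a b x y * p + lin b d x y * q)
      - (lin a b x1 y1 * p1 + lin b d x1 y1 * q1)); [| rewrite Hi, Hi1; ring].
    unfold g, h, P, Q, X, Y, lin; field. }
  assert (Ex : x - x1 = - ga * h).
  { transitivity ((g * (g * (x - x1) + h * (y - y1))) * / (g * g + h * h) - ga * h).
    - unfold ga; field; lra.
    - rewrite E1; ring. }
  assert (Ey : y - y1 = ga * g).
  { transitivity ((h * (g * (x - x1) + h * (y - y1))) * / (g * g + h * h) + ga * g).
    - unfold ga; field; lra.
    - rewrite E1; ring. }
  assert (Ep : p - p1 = - al * Q).
  { transitivity ((P * (P * (p - p1) + Q * (q - q1))) * / (P * P + Q * Q) - al * Q).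
    - unfold al; field; lra.
    - rewrite E2; ring. }
  assert (Eq : q - q1 = al * P).
  { transitivity ((Q * (P * (p - p1) + Q * (q - q1))) * / (P * P + Q * Q) + al * P).
    - unfold al; field; lra.
    - rewrite E2; ring. }
  (* The pair [(ga, al)] is parallel to [(S, C)], so the projection loses nothing. *)
  assert (E4 : ga * C = al * S).
  { rewrite Ex, Ey, Ep, Eq in E3.
    transitivity (al * S + (lin a b (- ga * h) (ga * g) * P + lin b d (- ga * h) (ga * g) * Q
      + g * (- al * Q) + h * (al * P))); [| rewrite E3; ring].
    unfold S, C, spd; fold g h; unfold rot, g, h, lin; ring. }
  assert (Hga : ga = (ga * S + al * C) * / (S * S + C * C) * S).
  { transitivity ((ga * S * S + (al * S) * C) * / (S * S + C * C)); [rewrite <- E4 |];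
      field; lra. }
  assert (Hal : al = (ga * S + al * C) * / (S * S + C * C) * C).
  { transitivity (((ga * C) * S + al * C * C) * / (S * S + C * C)); [rewrite E4 |];
      field; lra. }
  set (e := (ga * S + al * C) * / (S * S + C * C)) in *.
  rewrite Ex, Ey, Ep, Eq.
  split; [| split; [| split]]; [rewrite Hga at 1 | rewrite Hga at 1
    | rewrite Hal at 1 | rewrite Hal at 1]; ring.
Qed.

(* [D - J^2 (a + d) + J^4] is a multiple of the determinant of the dual matrix of the
   caustic; it vanishes when the chord lies on an axis of the ellipse. *)
Lemma flow_nonzero a b d J x y p q :
  ray a b d J x y p q ->
  a * d - b * b - J * J * (a + d) + J * J * (J * J) <> 0 ->
  0 < spd a b d x y p q ^ 2 * gsq a b d x y + rot a b d x y p q ^ 2.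
Proof.
  intros H Hchi.
  pose proof (rot_sq _ _ _ _ _ _ _ _ H) as Hc; pose proof (rot_frame _ _ _ _ _ _ _ _ H) as Hr.
  pose proof (frame_det _ _ _ _ _ _ _ _ H) as Hd; pose proof (frame_trace _ _ _ _ _ _ _ _ H) as Ht.
  pose proof (gsq_ge _ _ _ _ _ _ _ _ H) as Hg.
  destruct H as [HD HJ _ _ _].
  set (s := spd a b d x y p q) in *; set (c := rot a b d x y p q) in *.
  set (Q := qform a b d p q) in *; set (B := gsq a b d x y) in *.
  set (Z := a * q * q - 2 * b * p * q + d * p * p) in *.
  set (T := lin a b p q * q - lin b d p q * p) in *.
  assert (0 < J * J) by nra.
  assert (Hs2 : 0 <= s ^ 2) by apply pow2_ge_0.
  assert (Hc2 : 0 <= c ^ 2) by apply pow2_ge_0.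
  destruct (Req_dec c 0) as [Ec | Ec].
  - destruct (Req_dec s 0) as [Es | Es].
    (* Here [T = 0] and [Q = J * J], so the expression becomes [Q Z - Q (Q + Z) + Q^2 = 0]. *)
    + exfalso; apply Hchi.
      rewrite Ec, Es in Hr; rewrite Ec in Hc.
      assert (T = 0) by (apply (Rmult_eq_reg_l J); lra).
      assert (EQ : Q = J * J) by (apply (Rmult_eq_reg_l (a * d - b * b)); lra).
      rewrite <- Ht, <- Hd, EQ; rewrite H0; ring.
    + assert (0 < s ^ 2) by (apply pow2_gt_0; assumption). nra.
  - assert (0 < c ^ 2) by (apply pow2_gt_0; assumption). nra.
Qed.

(** At [t0] the motion does not vanish, by [flow_nonzero]. By continuity the denominators of [slope]
    stay positive nearby, so [eta] can be taken to be [slope]. *)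
Lemma flows_local a b d J (x y p q : R -> R) (t0 : R) :
  (forall t, ray a b d J (x t) (y t) (p t) (q t)) ->
  a * d - b * b - J * J * (a + d) + J * J * (J * J) <> 0 ->
  continuity x -> continuity y -> continuity p -> continuity q ->
  exists del eta X K, 0 < del /\ continuity X /\
    flows (fun t => Rabs (t - t0) < del) eta a b d x y p q /\
    forall s t, Rabs (s - t0) < del -> Rabs (t - t0) < del ->
      Rabs (eta s t) <= K * Rabs (X s - X t).
Proof.
  intros Hr Hchi Cx Cy Cp Cq.
  set (g := fun z : R * R => lin a b (mean x (fst z) (snd z)) (mean y (fst z) (snd z))).
  set (h := fun z : R * R => lin b d (mean x (fst z) (snd z)) (mean y (fst z) (snd z))).
  set (P := fun z : R * R => mean p (fst z) (snd z)).
  set (Q := fun z : R * R => mean q (fst z) (snd z)).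
  set (S := fun z : R * R => g z * Q z + - (h z * P z)).
  set (C := fun z : R * R => (a * d - b * b) *
    (mean x (fst z) (snd z) * Q z + - (mean y (fst z) (snd z) * P z))).
  set (z0 := (t0, t0)).
  assert (Mx := continuous_mean x t0 (Cx t0)); assert (My := continuous_mean y t0 (Cy t0)).
  assert (Mp : continuous P z0) by exact (continuous_mean p t0 (Cp t0)).
  assert (Mq : continuous Q z0) by exact (continuous_mean q t0 (Cq t0)).
  assert (K0 : forall k : R, continuous (fun _ : R * R => k) z0)
    by (intros; apply continuous_const).
  assert (Mg : continuous g z0)
    by (apply continuous_add; apply continuous_mul; auto).
  assert (Mh : continuous h z0)
    by (apply continuous_add; apply continuous_mul; auto).
  assert (MS : continuous S z0)
    by (apply continuous_add; [| apply continuous_neg]; apply continuous_mul; auto).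
  assert (MC : continuous C z0).
  { apply continuous_mul; [auto |]; apply continuous_add; [| apply continuous_neg];
      apply continuous_mul; auto. }
  assert (Em : forall z t, mean z t t = z t) by (intros; unfold mean; field).
  assert (Eg : g z0 = lin a b (x t0) (y t0)) by (unfold g, z0; simpl; now rewrite !Em).
  assert (Eh : h z0 = lin b d (x t0) (y t0)) by (unfold h, z0; simpl; now rewrite !Em).
  assert (EP : P z0 = p t0) by (unfold P, z0; simpl; now rewrite !Em).
  assert (EQ : Q z0 = q t0) by (unfold Q, z0; simpl; now rewrite !Em).
  assert (ES : S z0 = spd a b d (x t0) (y t0) (p t0) (q t0))
    by (unfold S; rewrite Eg, Eh, EP, EQ; reflexivity).
  assert (EC : C z0 = rot a b d (x t0) (y t0) (p t0) (q t0))
    by (unfold C; rewrite EP, EQ; unfold z0; simpl; rewrite !Em; reflexivity).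
  assert (HJ : 0 < J * J) by (pose proof (ray_J _ _ _ _ _ _ _ _ (Hr t0)); nra).
  assert (Hg0 := gsq_ge _ _ _ _ _ _ _ _ (Hr t0)); unfold gsq in Hg0.
  destruct (continuous_pair_pos (fun z => g z * g z + h z * h z) t0) as (d1 & Hd1 & D1).
  { apply continuous_add; apply continuous_mul; assumption. }
  { fold z0; rewrite Eg, Eh; lra. }
  destruct (continuous_pair_pos (fun z => P z * P z + Q z * Q z) t0) as (d2 & Hd2 & D2).
  { apply continuous_add; apply continuous_mul; assumption. }
  { fold z0; rewrite EP, EQ, (ray_unit _ _ _ _ _ _ _ _ (Hr t0)); lra. }
  (* The inner product of the motion at the midpoints with the fixed motion at [t0]; on the diagonal
     it is a squared length. *)
  set (W := fun z => S z0 * (S z * (g z0 * g z + h z0 * h z))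
                     + C z0 * (C z * (P z0 * P z + Q z0 * Q z))).
  assert (W0 : 0 < W z0).
  { replace (W z0) with (S z0 ^ 2 * (g z0 ^ 2 + h z0 ^ 2)
      + C z0 ^ 2 * (P z0 * P z0 + Q z0 * Q z0)) by (unfold W; ring).
    rewrite ES, EC, Eg, Eh, EP, EQ, (ray_unit _ _ _ _ _ _ _ _ (Hr t0)), Rmult_1_r.
    exact (flow_nonzero _ _ _ _ _ _ _ _ (Hr t0) Hchi). }
  destruct (continuous_pair_pos W t0) as (d3 & Hd3 & D3).
  { apply continuous_add; (apply continuous_mul; [apply K0 |]);
      (apply continuous_mul; [assumption |]); apply continuous_add;
      (apply continuous_mul; [apply K0 | assumption]). }
  { exact W0. }
  fold z0 in D1, D2, D3.
  destruct (bounded_near x t0 (Cx t0)) as (d4 & Hd4 & [K4 B4]).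
  destruct (bounded_near y t0 (Cy t0)) as (d5 & Hd5 & [K5 B5]).
  destruct (bounded_near p t0 (Cp t0)) as (d6 & Hd6 & [K6 B6]).
  destruct (bounded_near q t0 (Cq t0)) as (d7 & Hd7 & [K7 B7]).
  assert (Hdel : exists del, 0 < del /\ del <= d1 /\ del <= d2 /\ del <= d3 /\
    del <= d4 /\ del <= d5 /\ del <= d6 /\ del <= d7).
  { exists (Rmin d1 (Rmin d2 (Rmin d3 (Rmin d4 (Rmin d5 (Rmin d6 d7)))))).
    repeat apply Rmin_case_strong; intros; repeat split; lra. }
  destruct Hdel as (del & Hdel & L1 & L2 & L3 & L4 & L5 & L6 & L7).
  set (eta := fun s t => slope a b d (x s) (y s) (p s) (q s) (x t) (y t) (p t) (q t)).
  assert (Hinc : forall s t, Rabs (s - t0) < del -> Rabs (t - t0) < del ->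
     W z0 / 2 < W (s, t) /\
     x s - x t = eta s t * (- S (s, t) * h (s, t)) /\
     y s - y t = eta s t * (S (s, t) * g (s, t)) /\
     p s - p t = eta s t * (- C (s, t) * Q (s, t)) /\
     q s - q t = eta s t * (C (s, t) * P (s, t))).
  { intros s t Hs Ht.
    assert (HW : W z0 / 2 < W (s, t)) by (apply D3; lra).
    split; [exact HW |].
    apply (slope_spec a b d J (x s) (y s) (p s) (q s) (x t) (y t) (p t) (q t) (Hr s) (Hr t)).
    - assert (A : _) by exact (D1 s t ltac:(lra) ltac:(lra)).
      rewrite Eg, Eh in A; fold z0 in A; unfold g, h in A; simpl in A.
      fold (mean x s t) (mean y s t); lra.
    - assert (A : _) by exact (D2 s t ltac:(lra) ltac:(lra)).
      rewrite EP, EQ, (ray_unit _ _ _ _ _ _ _ _ (Hr t0)) in A; unfold P, Q in A; simpl in A.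
      fold (mean p s t) (mean q s t); lra.
    - change (0 < S (s, t) * S (s, t) + C (s, t) * C (s, t)).
      destruct (Req_dec (S (s, t)) 0) as [E | E]; [| nra].
      destruct (Req_dec (C (s, t)) 0) as [E' | E']; [| nra].
      exfalso; unfold W at 2 in HW; rewrite E, E' in HW; lra. }
  (* [X] is the inner product of the state with the motion at [t0]. Its increments are
     [eta s t * W (s, t)], and [W] exceeds half its value at [z0]. *)
  exists del, eta,
    (fun t => S z0 * (g z0 * y t - h z0 * x t) + C z0 * (P z0 * q t - Q z0 * p t)),
    (/ (W z0 / 2)).
  split; [assumption |]; split; [reg |]; split.
  - apply flows_of_increments.
    + exists K4; intros t Ht; apply B4; lra.
    + exists K5; intros t Ht; apply B5; lra.
    + exists K6; intros t Ht; apply B6; lra.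
    + exists K7; intros t Ht; apply B7; lra.
    + intros s t Hs Ht; apply (Hinc s t Hs Ht).
  - intros s t Hs Ht; destruct (Hinc s t Hs Ht) as (HW & Ex & Ey & Ep & Eq).
    replace (S z0 * (g z0 * y s - h z0 * x s) + C z0 * (P z0 * q s - Q z0 * p s) -
      (S z0 * (g z0 * y t - h z0 * x t) + C z0 * (P z0 * q t - Q z0 * p t)))
    with (eta s t * W (s, t)).
    + rewrite Rabs_mult, (Rabs_pos_eq (W (s, t))) by lra.
      apply (Rmult_le_reg_l (W z0 / 2)); [lra |].
      replace (W z0 / 2 * (/ (W z0 / 2) * (Rabs (eta s t) * W (s, t))))
        with (W (s, t) * Rabs (eta s t)) by (field; lra).
      apply Rmult_le_compat_r; [apply Rabs_pos | lra].
    + transitivity (S z0 * (g z0 * (y s - y t) - h z0 * (x s - x t))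
        + C z0 * (P z0 * (q s - q t) - Q z0 * (p s - p t))); [| ring].
      rewrite Ex, Ey, Ep, Eq; unfold W; ring.
Qed.

Lemma prod_factor_constant a b d J n (x y p q : R -> nat -> R) :
  (0 < n)%nat ->
  (forall t, bounces a b d J n (x t) (y t) (p t) (q t)) ->
  a * d - b * b - J * J * (a + d) + J * J * (J * J) <> 0 ->
  continuity (fun t => x t 0%nat) -> continuity (fun t => y t 0%nat) ->
  continuity (fun t => p t 0%nat) -> continuity (fun t => q t 0%nat) ->
  forall s t, prodR n (factor a b d n (x s) (y s) (p s) (q s))
            = prodR n (factor a b d n (x t) (y t) (p t) (q t)).
Proof.
  intros Hn Hb Hchi Cx Cy Cp Cq.
  apply (locally_constant_constant
    (fun t => prodR n (factor a b d n (x t) (y t) (p t) (q t)))).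
  intros t0.
  assert (Hr : forall t, ray a b d J (x t 0%nat) (y t 0%nat) (p t 0%nat) (q t 0%nat))
    by (intros t; exact (proj1 (Hb t 0%nat Hn))).
  destruct (flows_local a b d J _ _ _ _ t0 Hr Hchi Cx Cy Cp Cq)
    as (del & eta & X & K & Hdel & HX & HF & Heta).
  pose proof (ray_J _ _ _ _ _ _ _ _ (Hr t0)) as HJ.
  destruct (cder_prod_factor _ eta a b d J n x y p q HJ Hn (fun t _ => Hb t) HF)
    as [_ (m & [C Hm] & Hf)].
  exists del; split; [assumption |]; intros s Hs.
  (* Zero derivative bounds the increment by [C * eta^2], and [|eta|] is at most [K] times the
     increment of [X]. *)
  apply (eq_of_quadratic_bound X (fun t => prodR n (factor a b d n (x t) (y t) (p t) (q t)))
    (t0 - del) (t0 + del) (C * K * K)); [assumption | | apply Rabs_def2 in Hs; lra | lra].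
  intros u v Hu Hv.
  assert (Hu' : Rabs (u - t0) < del) by (apply Rabs_def1; lra).
  assert (Hv' : Rabs (v - t0) < del) by (apply Rabs_def1; lra).
  destruct (Hm u v Hu' Hv') as (M1 & _ & M2); rewrite Rminus_0_r in M2.
  rewrite (Hf u v Hu' Hv'), Rabs_mult.
  pose proof (Heta u v Hu' Hv') as He.
  pose proof (Rabs_pos (eta u v)); pose proof (Rabs_pos (m u v)).
  rewrite <- (pow2_abs (X u - X v)).
  set (e := Rabs (eta u v)) in *; set (w := Rabs (X u - X v)) in *.
  assert (HC : 0 <= C) by lra.
  apply Rle_trans with (e * (C * e)).
  - apply Rmult_le_compat_l; assumption.
  - replace (e * (C * e)) with (C * (e * e)) by ring.
    replace (C * K * K * w ^ 2) with (C * ((K * w) * (K * w))) by ring.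
    apply Rmult_le_compat_l; [assumption |]; apply Rmult_le_compat; assumption.
Qed.

(** * Billiard polygons *)

Lemma qform_posdef a b d x y :
  0 < a -> 0 < a * d - b * b -> (x <> 0 \/ y <> 0) -> 0 < qform a b d x y.
Proof.
  intros Ha HD Hxy.
  apply (Rmult_lt_reg_l a); [assumption |]; rewrite Rmult_0_r.
  replace (a * qform a b d x y) with ((a * x + b * y) ^ 2 + (a * d - b * b) * y ^ 2)
    by (unfold qform; ring).
  pose proof (pow2_ge_0 (a * x + b * y)); pose proof (pow2_ge_0 y).
  destruct (Req_dec y 0) as [-> | Hy].
  - destruct Hxy as [Hx | Hx]; [| lra].
    assert (0 < (a * x) ^ 2) by (apply pow2_gt_0; nra).
    replace (a * x + b * 0) with (a * x) by ring; nra.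
  - assert (0 < y ^ 2) by (apply pow2_gt_0; assumption); nra.
Qed.

Section Chord.
Context (a b d lam x y x1 y1 : R).
Let D := a * d - b * b.
(** [1 - e] is both minus the gradient at the start and plus the gradient at the end, paired with
    the chord. *)
Let e := lin a b x y * x1 + lin b d x y * y1.
Let J := sqrt (lam * D).
Context (Ha : 0 < a) (HD : 0 < D)
  (H0 : qform a b d x y = 1) (H1 : qform a b d x1 y1 = 1)
  (Hne : x1 - x <> 0 \/ y1 - y <> 0)
  (Htan : lam * D * ((x1 - x) * (x1 - x) + (y1 - y) * (y1 - y)) = (1 - e) * (1 - e)).

Lemma chord_qform : qform a b d (x1 - x) (y1 - y) = 2 * (1 - e).
Proof.
  transitivity (qform a b d x y + qform a b d x1 y1 - 2 * e).
  - unfold e, qform, lin; ring.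
  - rewrite H0, H1; ring.
Qed.

Lemma chord_pos : 0 < 1 - e.
Proof.
  pose proof (qform_posdef a b d (x1 - x) (y1 - y) Ha HD Hne) as Hq.
  rewrite chord_qform in Hq; lra.
Qed.

(** By [Htan], [lam * D] times the squared length of the chord is a positive square. This makes the
    square root [J] positive. *)
Lemma chord_lam : 0 < lam * D.
Proof.
  pose proof chord_pos as He.
  assert (He2 : 0 < (1 - e) * (1 - e)) by now apply Rmult_lt_0_compat.
  assert (Hd : 0 <= (x1 - x) * (x1 - x) + (y1 - y) * (y1 - y))
    by (apply Rplus_le_le_0_compat; apply Rle_0_sqr).
  rewrite <- Htan in He2.
  apply Rnot_le_lt; intros Hl.
  pose proof (Rmult_le_compat_r _ _ _ Hd Hl); lra.
Qed.

Lemma chord_J : 0 < J /\ J * J = lam * D.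
Proof.
  pose proof chord_lam; split; [now apply sqrt_lt_R0 | apply sqrt_sqrt; lra].
Qed.

(** [Htan] says that [1 - e] is [J] times the length of the chord, so this normalises the chord. *)
Let p := J * (x1 - x) * / (1 - e).
Let q := J * (y1 - y) * / (1 - e).

Lemma chord_ray : ray a b d J x y p q.
Proof.
  pose proof chord_pos as He; destruct chord_J as [HJ HJJ].
  split; try assumption.
  - transitivity (J * J * ((x1 - x) * (x1 - x) + (y1 - y) * (y1 - y))
      * / (1 - e) * / (1 - e)).
    + unfold p, q; field; lra.
    + rewrite HJJ, Htan; field; lra.
  - transitivity (J * / (1 - e) * (e - qform a b d x y)).
    + unfold p, q, e, qform, lin; field; fold (lin a b x y) (lin b d x y); fold e; lra.
    + rewrite H0; field; lra.
Qed.

Lemma chord_next :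
  x1 = x + 2 * J * / qform a b d p q * p /\ y1 = y + 2 * J * / qform a b d p q * q.
Proof.
  pose proof chord_pos as He; destruct chord_J as [HJ HJJ].
  assert (HQ : qform a b d p q = 2 * J * J * / (1 - e)).
  { transitivity (J * J * / (1 - e) * / (1 - e) * qform a b d (x1 - x) (y1 - y)).
    - unfold p, q, qform; ring.
    - rewrite chord_qform; field; lra. }
  rewrite HQ; unfold p, q; split; field; lra.
Qed.
End Chord.

(** * Angles between vectors *)

Lemma dot_self_pos u : u <> (0, 0) -> 0 < dot u u.
Proof.
  destruct u as [u1 u2]; unfold dot; simpl; intros Hu.
  destruct (Req_dec u1 0) as [E1 | E1]; [| nra].
  destruct (Req_dec u2 0) as [E2 | E2]; [| nra].
  exfalso; apply Hu; congruence.
Qed.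

Lemma vnorm_pos u : u <> (0, 0) -> 0 < vnorm u.
Proof. intros Hu; apply sqrt_lt_R0; now apply dot_self_pos. Qed.

(** The identity [dot^2 + cross^2 = |u|^2 |v|^2] puts the quotient in [[-1, 1]], where [cos] undoes
    [acos]. *)
Lemma cos_vangle u v :
  u <> (0, 0) -> v <> (0, 0) -> cos (vangle u v) = dot u v / (vnorm u * vnorm v).
Proof.
  intros Hu Hv; apply cos_acos.
  pose proof (vnorm_pos u Hu) as Nu; pose proof (vnorm_pos v Hv) as Nv.
  assert (Su : vnorm u * vnorm u = dot u u)
    by (apply sqrt_sqrt; pose proof (dot_self_pos u Hu); lra).
  assert (Sv : vnorm v * vnorm v = dot v v)
    by (apply sqrt_sqrt; pose proof (dot_self_pos v Hv); lra).
  assert (HN : 0 < vnorm u * vnorm v) by nra.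
  assert (HCS : Rabs (dot u v) <= vnorm u * vnorm v).
  { rewrite <- (Rabs_pos_eq (vnorm u * vnorm v)) by lra.
    apply Rsqr_le_abs_0; unfold Rsqr.
    replace (vnorm u * vnorm v * (vnorm u * vnorm v)) with (dot u u * dot v v)
      by (rewrite <- Su, <- Sv; ring).
    replace (dot u u * dot v v) with (dot u v * dot u v + cross u v * cross u v)
      by (unfold dot, cross; ring).
    nra. }
  apply Rabs_le_between in HCS; split.
  - apply (Rmult_le_reg_r (vnorm u * vnorm v)); [assumption |].
    unfold Rdiv; rewrite Rmult_assoc, Rinv_l; lra.
  - apply (Rmult_le_reg_r (vnorm u * vnorm v)); [assumption |].
    unfold Rdiv; rewrite Rmult_assoc, Rinv_l; lra.
Qed.

Lemma vnorm_scal k u1 u2 : vnorm (k * u1, k * u2) = Rabs k * vnorm (u1, u2).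
Proof.
  unfold vnorm, dot; simpl.
  replace (k * u1 * (k * u1) + k * u2 * (k * u2)) with (k * k * (u1 * u1 + u2 * u2)) by ring.
  rewrite sqrt_mult_alt by nra; f_equal; apply sqrt_Rsqr_abs.
Qed.

Lemma cos_vangle_scal k l u1 u2 v1 v2 :
  0 < k -> 0 < l -> (u1, u2) <> (0, 0) -> (v1, v2) <> (0, 0) ->
  cos (vangle (k * u1, k * u2) (l * v1, l * v2))
  = (u1 * v1 + u2 * v2) / (vnorm (u1, u2) * vnorm (v1, v2)).
Proof.
  intros Hk Hl Hu Hv; pose proof (vnorm_pos _ Hu); pose proof (vnorm_pos _ Hv).
  assert (Hs : forall m w1 w2, 0 < m -> (w1, w2) <> (0, 0) -> (m * w1, m * w2) <> (0, 0)).
  { intros m w1 w2 Hm Hw E; apply Hw; injection E as E1 E2.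
    f_equal; [apply (Rmult_eq_reg_l m) | apply (Rmult_eq_reg_l m)]; lra. }
  rewrite cos_vangle by (apply Hs; assumption).
  rewrite !vnorm_scal, !Rabs_pos_eq by lra.
  unfold dot; simpl; field; lra.
Qed.

Lemma gsq_vnorm a b d x y :
  sqrt (gsq a b d x y) = vnorm (lin a b x y, lin b d x y).
Proof. unfold gsq, vnorm, dot; simpl; f_equal; ring. Qed.

(** * Rays of a billiard polygon and the angles between its tangents *)

Section Polygon.
Context (E : ellipse) (n : nat) (lam : R) (P : nat -> pt).
Let a := ea E.
Let b := eb E.
Let d := ed E.
Let X i := fst (vsub (P i) (ec E)).
Let Y i := snd (vsub (P i) (ec E)).
Let e i := lin a b (X i) (Y i) * X (nxt n i) + lin b d (X i) (Y i) * Y (nxt n i).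
Let J := sqrt (lam * (a * d - b * b)).
Let p i := J * (X (nxt n i) - X i) * / (1 - e i).
Let q i := J * (Y (nxt n i) - Y i) * / (1 - e i).
Context (HE : is_ellipse E) (Hn : (2 <= n)%nat) (HB : billiard_traj E n P)
  (HT : forall i, (i < n)%nat -> line_tangent_confocal E lam (P i) (P (nxt n i))).

Let Hnxt i : (i < n)%nat -> (nxt n i < n)%nat.
Proof. intros; apply nxt_lt; lia. Qed.

Lemma vertex_ell i : (i < n)%nat -> qform a b d (X i) (Y i) = 1.
Proof. intros Hi; exact (proj1 (HB i Hi)). Qed.

Lemma edge_ne i : (i < n)%nat -> X (nxt n i) - X i <> 0 \/ Y (nxt n i) - Y i <> 0.
Proof.
  intros Hi; destruct (HB i Hi) as (_ & Hne & _).
  destruct (Req_dec (X (nxt n i) - X i) 0) as [Ex | Ex]; [right | left; assumption].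
  intros Ey; apply Hne; unfold X, Y, vsub in Ex, Ey; simpl in Ex, Ey.
  apply injective_projections; lra.
Qed.

(** Multiplying the dual equation by [det A] turns the inverse matrix into the adjugate, whose form
    at the normal is the form of the chord, [2 (1 - e)]. The right side becomes the Gram determinant
    [1 - e^2], and the difference is [(1 - e)^2]. *)
Lemma edge_tangent i : (i < n)%nat ->
  lam * (a * d - b * b) * ((X (nxt n i) - X i) * (X (nxt n i) - X i)
    + (Y (nxt n i) - Y i) * (Y (nxt n i) - Y i)) = (1 - e i) * (1 - e i).
Proof.
  intros Hi; pose proof (HT i Hi) as Ht.
  pose proof (vertex_ell i Hi) as H0; pose proof (vertex_ell _ (Hnxt i Hi)) as H1.
  destruct HE as [Ha HD]; fold a b d in Ha, HD.
  unfold line_tangent_confocal, confM11, confM12, confM22, detA, dot in Ht.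
  fold a b d in Ht.
  set (x := X i) in *; set (y := Y i) in *.
  set (x1 := X (nxt n i)) in *; set (y1 := Y (nxt n i)) in *.
  assert (Ex : fst (vsub (P (nxt n i)) (P i)) = x1 - x)
    by (unfold x, x1, X, vsub; simpl; ring).
  assert (Ey : snd (vsub (P (nxt n i)) (P i)) = y1 - y)
    by (unfold y, y1, Y, vsub; simpl; ring).
  rewrite Ex, Ey in Ht; simpl fst in Ht; simpl snd in Ht.
  change (fst (vsub (P i) (ec E))) with x in Ht.
  change (snd (vsub (P i) (ec E))) with y in Ht.
  change (fst (P i) - fst (ec E)) with x in Ht.
  change (snd (P i) - snd (ec E)) with y in Ht.
  assert (Hq : qform a b d (x1 - x) (y1 - y) = 2 * (1 - e i)) by exact (chord_qform _ _ _ _ _ _ _ H0 H1).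
  assert (Hg : (a * d - b * b) * ((x * y1 - y * x1) * (x * y1 - y * x1)) = 1 - e i * e i).
  { transitivity (qform a b d x y * qform a b d x1 y1 - e i * e i);
      [| rewrite H0, H1; ring].
    unfold e; fold x y x1 y1; unfold qform, lin; ring. }
  set (De := a * d - b * b) in *.
  transitivity (qform a b d (x1 - x) (y1 - y)
    - De * ((d / De - lam) * - (y1 - y) * - (y1 - y) +
       2 * (- b / De) * - (y1 - y) * (x1 - x) + (a / De - lam) * (x1 - x) * (x1 - x))).
  - unfold qform; field; lra.
  - rewrite Ht, Hq.
    replace (De * ((- (y1 - y) * x + (x1 - x) * y) * (- (y1 - y) * x + (x1 - x) * y)))
      with (De * ((x * y1 - y * x1) * (x * y1 - y * x1))) by ring.
    rewrite Hg; ring.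
Qed.

Lemma edge_pos i : (i < n)%nat -> 0 < 1 - e i.
Proof.
  intros Hi; destruct HE as [Ha HD].
  exact (chord_pos a b d _ _ _ _ Ha HD (vertex_ell i Hi) (vertex_ell _ (Hnxt i Hi)) (edge_ne i Hi)).
Qed.

Lemma edge_J : 0 < J /\ J * J = lam * (a * d - b * b).
Proof.
  assert (Hi : (0 < n)%nat) by lia; destruct HE as [Ha HD].
  exact (chord_J a b d lam _ _ _ _ Ha HD (vertex_ell _ Hi) (vertex_ell _ (Hnxt _ Hi))
    (edge_ne _ Hi) (edge_tangent _ Hi)).
Qed.

Lemma edge_ray i : (i < n)%nat -> ray a b d J (X i) (Y i) (p i) (q i).
Proof.
  intros Hi; destruct HE as [Ha HD].
  exact (chord_ray a b d lam _ _ _ _ Ha HD (vertex_ell i Hi) (vertex_ell _ (Hnxt i Hi))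
    (edge_ne i Hi) (edge_tangent i Hi)).
Qed.

Lemma grad_nonzero i : (i < n)%nat -> (lin a b (X i) (Y i), lin b d (X i) (Y i)) <> (0, 0).
Proof.
  intros Hi Eq; injection Eq as E1 E2.
  pose proof (gsq_ge _ _ _ _ _ _ _ _ (edge_ray i Hi)) as Hg.
  unfold gsq in Hg; rewrite E1, E2 in Hg; destruct edge_J; nra.
Qed.

(** Seen from the vertex, the sides have unit directions [- w_i] and [w_j]. The cosines of their
    angles with the opposite tangent directions are [- spd / |g|] for the two rays. *)
Lemma reflection_spd i : (i < n)%nat ->
  spd a b d (X (nxt n i)) (Y (nxt n i)) (p i) (q i)
  = spd a b d (X (nxt n i)) (Y (nxt n i)) (p (nxt n i)) (q (nxt n i)).
Proof.
  intros Hi; pose proof (Hnxt i Hi) as Hj.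
  destruct (HB _ Hj) as (_ & _ & Href); rewrite prv_nxt in Href by assumption.
  destruct edge_J as [HJ _].
  pose proof (edge_pos _ Hi) as Pi; pose proof (edge_pos _ Hj) as Pj.
  pose proof (edge_ray _ Hi) as Ri; pose proof (edge_ray _ Hj) as Rj.
  set (j := nxt n i) in *.
  set (g := lin a b (X j) (Y j)); set (h := lin b d (X j) (Y j)).
  (* [(1 - e i) * / J] is the length of side [i]. *)
  assert (E1 : vsub (P i) (P j) = ((1 - e i) * / J * - p i, (1 - e i) * / J * - q i)).
  { unfold p, q; fold j; unfold X, Y, vsub; simpl; f_equal; field; lra. }
  assert (E2 : vsub (P (nxt n j)) (P j) = ((1 - e j) * / J * p j, (1 - e j) * / J * q j)).
  { unfold p, q, X, Y, vsub; simpl; f_equal; field; lra. }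
  assert (E3 : tangent_dir E (P j) = (1 * - h, 1 * g))
    by (change (tangent_dir E (P j)) with (- h, g); f_equal; ring).
  assert (E4 : vopp (1 * - h, 1 * g) = (1 * h, 1 * - g))
    by (unfold vopp; simpl; f_equal; ring).
  rewrite E1, E2, E3, E4 in Href.
  assert (Hk : forall m, 0 < 1 - e m -> 0 < (1 - e m) * / J)
    by (intros m Hm; apply Rmult_lt_0_compat; [| apply Rinv_0_lt_compat]; assumption).
  assert (Hgh : 0 < vnorm (g, h)) by (apply vnorm_pos; exact (grad_nonzero j Hj)).
  assert (N1 : vnorm (- h, g) = vnorm (g, h)) by (unfold vnorm, dot; simpl; f_equal; ring).
  assert (N2 : vnorm (h, - g) = vnorm (g, h)) by (unfold vnorm, dot; simpl; f_equal; ring).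
  assert (N3 : vnorm (- p i, - q i) = 1).
  { unfold vnorm, dot; simpl.
    replace (- p i * - p i + - q i * - q i) with (p i * p i + q i * q i) by ring.
    rewrite (ray_unit _ _ _ _ _ _ _ _ Ri); apply sqrt_1. }
  assert (N4 : vnorm (p j, q j) = 1).
  { unfold vnorm, dot; simpl; rewrite (ray_unit _ _ _ _ _ _ _ _ Rj); apply sqrt_1. }
  assert (Hnz : forall u, 0 < vnorm u -> u <> (0, 0)).
  { intros u Hu ->; unfold vnorm, dot in Hu; simpl in Hu.
    replace (0 * 0 + 0 * 0) with 0 in Hu by ring; rewrite sqrt_0 in Hu; lra. }
  apply (f_equal cos) in Href.
  rewrite !cos_vangle_scal in Href by (first [apply Hk; assumption | lra | apply Hnz; lra]).
  rewrite N1, N2, N3, N4 in Href.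
  unfold spd; fold g h.
  apply (Rmult_eq_reg_r (/ (1 * vnorm (g, h)))).
  - unfold Rdiv in Href.
    transitivity ((- p i * - h + - q i * g) * / (1 * vnorm (g, h)) * -1); [ring |].
    rewrite Href; ring.
  - apply Rinv_neq_0_compat; lra.
Qed.

Lemma polygon_bounces : bounces a b d J n X Y p q.
Proof.
  intros i Hi; destruct HE as [Ha HD].
  destruct (chord_next a b d lam _ _ _ _ Ha HD (vertex_ell i Hi) (vertex_ell _ (Hnxt i Hi))
    (edge_ne i Hi) (edge_tangent i Hi)) as [Nx Ny].
  split; [exact (edge_ray i Hi) |]; split; [exact Nx |]; split; [exact Ny |].
  exact (reflection_spd i Hi).
Qed.

(** Seen from the intersection of the tangents, the two vertices lie along quarter turns of their
    gradients in opposite senses, which gives the minus sign. The common scale [k] enters squared,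
    so its sign does not affect the angle. *)
Lemma cos_beta i : (i < n)%nat ->
  cross (grad E (P i)) (grad E (P (nxt n i))) <> 0 ->
  cos (beta E n P i)
  = - (a * d - b * b - J * J * (a + d)) * factor a b d n X Y p q i.
Proof.
  intros Hi Hcr; pose proof (Hnxt i Hi) as Hj; unfold beta.
  pose proof (edge_pos i Hi) as He.
  destruct (polygon_bounces i Hi) as (Hr & Nx & Ny & _).
  pose proof (grad_dot_step _ _ _ _ _ _ _ _ Hr) as Hdot.
  rewrite <- Nx, <- Ny in Hdot.
  unfold factor; rewrite !gsq_vnorm.
  pose proof (grad_nonzero i Hi) as G1; pose proof (grad_nonzero _ Hj) as G2.
  set (j := nxt n i) in *.
  pose proof (vertex_ell i Hi) as H0; pose proof (vertex_ell j Hj) as H1.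
  set (g1 := lin a b (X i) (Y i)) in *; set (h1 := lin b d (X i) (Y i)) in *.
  set (g2 := lin a b (X j) (Y j)) in *; set (h2 := lin b d (X j) (Y j)) in *.
  change (grad E (P i)) with (g1, h1) in Hcr.
  change (grad E (P j)) with (g2, h2) in Hcr.
  set (De := g1 * h2 - h1 * g2); change (De <> 0) in Hcr.
  set (k := (1 - e i) * / De).
  assert (D1 : g1 * (fst (P j) - fst (P i)) + h1 * (snd (P j) - snd (P i)) = - (1 - e i)).
  { transitivity (e i - qform a b d (X i) (Y i)); [| rewrite H0; ring].
    unfold e; fold j; unfold g1, h1, qform, lin, X, Y, vsub; simpl; ring. }
  assert (D2 : g2 * (fst (P j) - fst (P i)) + h2 * (snd (P j) - snd (P i)) = 1 - e i).
  { transitivity (qform a b d (X j) (Y j) - e i); [| rewrite H1; ring].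
    unfold e; fold j; unfold g2, h2, qform, lin, X, Y, vsub; simpl; ring. }
  assert (E1 : vsub (P i) (tangent_intersection E (P i) (P j)) = (k * h1, k * - g1)).
  { unfold vsub, tangent_intersection.
    change (grad E (P i)) with (g1, h1); change (grad E (P j)) with (g2, h2).
    unfold cross, dot, k; simpl; fold De; rewrite <- D2; f_equal;
      unfold De; field; exact Hcr. }
  assert (E2 : vsub (P j) (tangent_intersection E (P i) (P j)) = (k * - h2, k * g2)).
  { unfold vsub, tangent_intersection.
    change (grad E (P i)) with (g1, h1); change (grad E (P j)) with (g2, h2).
    unfold cross, dot, k; simpl; fold De.
    replace (1 - e i) with (- (g1 * (fst (P j) - fst (P i)) + h1 * (snd (P j) - snd (P i))))
      by lra.
    f_equal; unfold De; field; exact Hcr. }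
  rewrite E1, E2.
  assert (N : forall g h, vnorm (h, - g) = vnorm (g, h))
    by (intros; unfold vnorm, dot; simpl; f_equal; ring).
  assert (N' : forall g h, vnorm (- h, g) = vnorm (g, h))
    by (intros; unfold vnorm, dot; simpl; f_equal; ring).
  pose proof (vnorm_pos _ G1) as V1; pose proof (vnorm_pos _ G2) as V2.
  assert (Hk : k <> 0).
  { unfold k; apply Rmult_integral_contrapositive_currified; [lra |].
    now apply Rinv_neq_0_compat. }
  rewrite cos_vangle.
  - rewrite !vnorm_scal, N, N'.
    transitivity (- (g1 * g2 + h1 * h2) * / (vnorm (g1, h1) * vnorm (g2, h2))).
    + unfold dot; simpl.
      assert (HK : Rabs k * Rabs k = k * k) by (rewrite <- Rabs_mult; apply Rabs_pos_eq; nra).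
      replace (Rabs k * vnorm (g1, h1) * (Rabs k * vnorm (g2, h2)))
        with (k * k * (vnorm (g1, h1) * vnorm (g2, h2))) by (rewrite <- HK; ring).
      field; lra.
    + rewrite Hdot, Rinv_mult; ring.
  - intros Eq; injection Eq as Ea Eb; apply G1; f_equal; apply (Rmult_eq_reg_l k); lra.
  - intros Eq; injection Eq as Ea Eb; apply G2; f_equal; apply (Rmult_eq_reg_l k); lra.
Qed.
End Polygon.

(* Clamping time extends the family to all of R, keeping it continuous. *)
Definition clamp (t1 t2 r : R) : R := Rmax t1 (Rmin t2 r).

Lemma clamp_between t1 t2 r : t1 <= t2 -> t1 <= clamp t1 t2 r <= t2.
Proof.
  intros; unfold clamp; apply Rmax_case_strong; apply Rmin_case_strong; lra.
Qed.

Lemma clamp_id t1 t2 r : t1 <= r <= t2 -> clamp t1 t2 r = r.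
Proof.
  intros; unfold clamp; rewrite Rmin_right, Rmax_right; lra.
Qed.

Lemma clamp_lipschitz t1 t2 r s : Rabs (clamp t1 t2 r - clamp t1 t2 s) <= Rabs (r - s).
Proof.
  unfold clamp, Rmax, Rmin, Rabs; repeat (case Rle_dec || case Rcase_abs); intros; lra.
Qed.

(** * Constancy of the cosine product along the family *)

Lemma abs_fst_le_vnorm u : Rabs (fst u) <= vnorm u.
Proof.
  rewrite <- sqrt_Rsqr_abs; apply sqrt_le_1_alt; unfold Rsqr, dot; nra.
Qed.

Lemma abs_snd_le_vnorm u : Rabs (snd u) <= vnorm u.
Proof.
  rewrite <- sqrt_Rsqr_abs; apply sqrt_le_1_alt; unfold Rsqr, dot; nra.
Qed.

Lemma prod_cos_beta_ordered (E : ellipse) (n : nat) (I : R -> Prop) (P : R -> nat -> pt) :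
  is_ellipse E -> (2 <= n)%nat -> billiard_family E n I P ->
  (forall t i, I t -> (i < n)%nat ->
     cross (grad E (P t i)) (grad E (P t (nxt n i))) <> 0) ->
  forall t s, I t -> I s -> t <= s ->
    prodR n (fun i => cos (beta E n (P t) i)) =
    prodR n (fun i => cos (beta E n (P s) i)).
Proof.
  intros HE Hn (HI & HB & Hcont & lam & Hlam & HT) Hcr t1 t2 Ht1 Ht2 Hle.
  set (a := ea E); set (b := eb E); set (d := ed E).
  set (J := sqrt (lam * (a * d - b * b))).
  set (cl := clamp t1 t2).
  assert (Hcl : forall r, I (cl r))
    by (intros r; apply (HI t1 t2); [assumption | assumption | now apply clamp_between]).
  set (X := fun r i => fst (vsub (P (cl r) i) (ec E))).
  set (Y := fun r i => snd (vsub (P (cl r) i) (ec E))).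
  set (e := fun r i => lin a b (X r i) (Y r i) * X r (nxt n i)
                     + lin b d (X r i) (Y r i) * Y r (nxt n i)).
  set (p := fun r i => J * (X r (nxt n i) - X r i) * / (1 - e r i)).
  set (q := fun r i => J * (Y r (nxt n i) - Y r i) * / (1 - e r i)).
  assert (Hb : forall r, bounces a b d J n (X r) (Y r) (p r) (q r)).
  { intros r; apply (polygon_bounces E n lam (P (cl r)) HE Hn (HB _ (Hcl r))).
    intros i Hi; apply HT; auto. }
  assert (He : forall r i, (i < n)%nat -> 0 < 1 - e r i).
  { intros r i Hi; exact (edge_pos E n (P (cl r)) HE Hn (HB _ (Hcl r)) i Hi). }
  (* Clamping does not increase distances in time, so the same [del] serves. *)
  assert (HP : forall i r eps, (i < n)%nat -> 0 < eps -> exists del, 0 < del /\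
    forall s, Rabs (s - r) < del -> vnorm (vsub (P (cl s) i) (P (cl r) i)) < eps).
  { intros i r eps Hi Heps.
    destruct (Hcont i (cl r) Hi (Hcl r) eps Heps) as (del & Hdel & Hd).
    exists del; split; [assumption |]; intros s Hs; apply Hd; [apply Hcl |].
    eapply Rle_lt_trans; [apply clamp_lipschitz | assumption]. }
  assert (CX : forall i, (i < n)%nat -> continuity (fun r => X r i)).
  { intros i Hi r eps Heps; destruct (HP i r eps Hi Heps) as (del & Hdel & Hd).
    exists del; split; [assumption |]; intros s [_ Hs].
    change (Rabs (X s i - X r i) < eps).
    eapply Rle_lt_trans; [| exact (Hd s Hs)].
    replace (X s i - X r i) with (fst (vsub (P (cl s) i) (P (cl r) i)))
      by (unfold X, vsub; simpl; ring).
    apply abs_fst_le_vnorm. }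
  assert (CY : forall i, (i < n)%nat -> continuity (fun r => Y r i)).
  { intros i Hi r eps Heps; destruct (HP i r eps Hi Heps) as (del & Hdel & Hd).
    exists del; split; [assumption |]; intros s [_ Hs].
    change (Rabs (Y s i - Y r i) < eps).
    eapply Rle_lt_trans; [| exact (Hd s Hs)].
    replace (Y s i - Y r i) with (snd (vsub (P (cl s) i) (P (cl r) i)))
      by (unfold Y, vsub; simpl; ring).
    apply abs_snd_le_vnorm. }
  assert (H0 : (0 < n)%nat) by lia; pose proof (nxt_lt n 0 H0) as H1.
  pose proof (CX _ H0) as CX0; pose proof (CX _ H1) as CX1.
  pose proof (CY _ H0) as CY0; pose proof (CY _ H1) as CY1.
  assert (Ck : forall k : R, continuity (fun _ => k))
    by (intros; apply continuity_const; intros ? ?; reflexivity).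
  assert (Cadd : forall f g, continuity f -> continuity g -> continuity (fun r => f r + g r))
    by exact continuity_plus.
  assert (Cmul : forall f g, continuity f -> continuity g -> continuity (fun r => f r * g r))
    by exact continuity_mult.
  assert (Csub : forall f g, continuity f -> continuity g -> continuity (fun r => f r - g r))
    by exact continuity_minus.
  assert (Ce : continuity (fun r => / (1 - e r 0%nat))).
  { apply (continuity_inv (fun r => 1 - e r 0%nat));
      [| intros r; pose proof (He r 0%nat H0); lra].
    apply Csub; [apply Ck |]; unfold e, lin; auto 12. }
  (* With [J * J = lam * D], this is [D^2] times the determinant of the dual matrix of the
     caustic. *)
  assert (Hchi : a * d - b * b - J * J * (a + d) + J * J * (J * J) <> 0).
  { assert (EJ : J * J = lam * (a * d - b * b)).
    { apply (edge_J E n lam (P (cl 0)) HE Hn (HB _ (Hcl 0))).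
      intros i Hi; apply HT; auto. }
    rewrite EJ; intros Hz; apply Hlam.
    destruct HE as [_ HD]; fold a b d in HD.
    unfold confM11, confM12, confM22, detA; fold a b d.
    apply (Rmult_eq_reg_l ((a * d - b * b) * (a * d - b * b))); [| nra].
    rewrite Rmult_0_r, <- Hz; field; lra. }
  assert (Hmain := prod_factor_constant a b d J n X Y p q H0 Hb Hchi CX0 CY0
    ltac:(unfold p; auto 12) ltac:(unfold q; auto 12) t1 t2).
  (* The prefactor depends only on the ellipse and [lam], so its [n]-th power is the same at all
     times. *)
  assert (Hcos : forall r, prodR n (fun i => cos (beta E n (P (cl r)) i))
    = (- (a * d - b * b - J * J * (a + d))) ^ n
      * prodR n (factor a b d n (X r) (Y r) (p r) (q r))).
  { intros r; rewrite <- prodR_scal; apply prodR_ext; intros i Hi.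
    apply (cos_beta E n lam (P (cl r)) HE Hn (HB _ (Hcl r))); [| assumption | auto].
    intros k Hk; apply HT; auto. }
  pose proof (Hcos t1) as E1; pose proof (Hcos t2) as E2.
  unfold cl in E1 at 1, E2 at 1; rewrite clamp_id in E1, E2 by lra.
  rewrite E1, E2, Hmain; reflexivity.
Qed.

Theorem theorem1p2 (E : ellipse) (n : nat) (I : R -> Prop) (P : R -> nat -> pt) :
  is_ellipse E ->
  (2 <= n)%nat ->
  billiard_family E n I P ->
  (* tangent lines at consecutive vertices are never parallel *)
  (forall t i, I t -> (i < n)%nat ->
     cross (grad E (P t i)) (grad E (P t (nxt n i))) <> 0) ->
  forall t s, I t -> I s ->
    prodR n (fun i => cos (beta E n (P t) i)) =
    prodR n (fun i => cos (beta E n (P s) i)).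
Proof.
  intros HE Hn HF Hcr t s Ht Hs; destruct (Rle_or_lt t s) as [Hle | Hlt].
  - exact (prod_cos_beta_ordered E n I P HE Hn HF Hcr t s Ht Hs Hle).
  - symmetry; apply (prod_cos_beta_ordered E n I P HE Hn HF Hcr s t Hs Ht); lra.
Qed.
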